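(* Every solvable subgroup of $PL_o(I)$ embeds in every non-solvable subgroup of $PL_o(I)$; that is, if $S$ and $H$ are subgroups of $PL_o(I)$ with $S$ solvable and $H$ non-solvable, then $H$ has a subgroup isomorphic to $S$.
   Context: $PL_o(I)$ denotes the group, under composition, of orientation-preserving piecewise-linear homeomorphisms of the unit interval $I=[0,1]$ which admit finitely many breaks in slope. *)

(* Defs.v *)
From HB Require Import structures.
From mathcomp Require Import all_boot all_order all_algebra.
From mathcomp Require Import all_classical all_reals all_analysis.

Set Implicit Arguments.
Unset Strict Implicit.
Unset Printing Implicit Defensive.

Import Order.TTheory GRing.Theory Num.Theory.
Import numFieldNormedType.Exports.

Local Open Scope classical_set_scope.
Local Open Scope ring_scope.

Section Groups.
Local Open Scope group_scope.
Implicit Types G : groupType.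

Definition subgroup G (A : set G) : Prop := group_closed [in A].

Definition derived_subgroup G (A : set G) : set G :=
  smallest (@subgroup G) [set z | exists x y, [/\ A x, A y & z = [~ x, y]]].

Definition derived_series G (n : nat) (A : set G) : set G :=
  iter n (@derived_subgroup G) A.

Definition is_solvable G (A : set G) : Prop :=
  exists n, derived_series n A = [set 1].

Definition isomorphic G1 G2 (A : set G1) (B : set G2) : Prop :=
  exists phi : G1 -> G2,
    {in A &, {morph phi : x y / x * y}} /\ set_bij A B phi.

End Groups.

Definition homeomorphism (X Y : topologicalType) (f : X -> Y) : Prop :=
  continuous f /\
  exists g : Y -> X, [/\ cancel f g, cancel g f & continuous g].

Notation unitI R := (set_type (`[0%R, 1%R]%classic : set R)).

Section PiecewiseLinear.
Variable R : realType.
Implicit Types f g : unitI R -> unitI R.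

Definition orientation_preserving f : Prop :=
  {homo f : x y / \val x < \val y}.

Definition affine_between f (a b : unitI R) : Prop :=
  exists m c : R, forall x : unitI R,
    \val a <= \val x <= \val b -> \val (f x) = m * \val x + c.

(* The finite list [B] cuts the interval into pieces on each of which [f] is
   affine; the breaks in slope of [f] are among the points of [B]. *)
Definition piecewise_linear f : Prop :=
  exists B : seq (unitI R), forall a b : unitI R,
    (forall x, x \in B -> ~~ (\val a < \val x < \val b)) -> affine_between f a b.

Definition is_PLo f : Prop :=
  [/\ homeomorphism f, orientation_preserving f & piecewise_linear f].

End PiecewiseLinear.

Record PLo (R : realType) : Type := MkPLo {
  PLo_fun :> unitI R -> unitI R;
  _ : `[< is_PLo PLo_fun >] }.

HB.instance Definition _ (R : realType) := [isSub for @PLo_fun R].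
HB.instance Definition _ (R : realType) := [Choice of PLo R by <:].

Section PLoGroup.
Variable R : realType.
Implicit Types f g h : PLo R.

Lemma PLoP f : is_PLo f.
Proof. by case: f => f /= /asboolP. Qed.

Lemma PLo_ext f g : (forall x, f x = g x) -> f = g.
Proof. by move=> fg; apply/val_inj/funext. Qed.

Lemma is_PLo_id : is_PLo (@id (unitI R)).
Proof.
split.
- by split; [move=> x; exact: cvg_id|exists id; split=> // x; exact: cvg_id].
- by [].
- by exists [::] => a b _; exists 1, 0 => x _; rewrite mul1r addr0.
Qed.

Lemma orientation_preservingW (f : unitI R -> unitI R) :
  orientation_preserving f -> {homo f : x y / \val x <= \val y}.
Proof.
move=> fh x y; rewrite le_eqVlt => /orP[/eqP/val_inj->//|/fh]; exact: ltW.
Qed.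

Lemma is_PLo_comp (f g : unitI R -> unitI R) :
  is_PLo f -> is_PLo g -> is_PLo (f \o g).
Proof.
move=> [[cf [f' [fK f'K cf']]] fh [B fB]] [[cg [g' [gK g'K cg']]] gh [C gC]].
split.
- split; first by move=> x; apply: continuous_comp; [exact: cg|exact: cf].
  exists (g' \o f'); split; [exact: can_comp|exact: can_comp|].
  by move=> x; apply: continuous_comp; [exact: cf'|exact: cg'].
- by move=> x y xy; apply/fh/gh.
exists (C ++ map g' B) => a b abP.
have [m [c gE]] : affine_between g a b.
  by apply: gC => x xC; apply: abP; rewrite mem_cat xC.
have [|n [d fE]] := fB (g a) (g b).
  move=> x xB; apply/negP => /andP[ax xb].
  have /negP[] : ~~ (\val a < \val (g' x) < \val b).
    by apply: abP; rewrite mem_cat map_f ?orbT.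
  apply/andP; split; rewrite ltNge; apply/negP.
  - by move/(orientation_preservingW gh); rewrite g'K leNgt ax.
  - by move/(orientation_preservingW gh); rewrite g'K leNgt xb.
exists (n * m), (n * c + d) => x abx; rewrite /= fE.
  by rewrite gE// mulrDr mulrA addrA.
by case/andP: abx => ax xb; rewrite !(orientation_preservingW gh).
Qed.

Lemma is_PLo_inv (f g : unitI R -> unitI R) :
  is_PLo f -> cancel f g -> cancel g f -> is_PLo g.
Proof.
move=> [[cf [f' [fK f'K cf']]] fh [B fB]] fg gf.
have gE : g = f' by apply/funext => x; rewrite -[in LHS](f'K x) fg.
have gh : orientation_preserving g.
  move=> x y xy; rewrite ltNge; apply/negP => /(orientation_preservingW fh).
  by rewrite !gf leNgt xy.
have gW := orientation_preservingW gh.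
split=> //; first by split; [rewrite gE|exists f; split].
exists (map f B) => a b abP.
have [|m [c fE]] := fB (g a) (g b).
  move=> x xB; apply/negP => /andP[ax xb].
  have /negP[] := abP _ (map_f f xB).
  by rewrite -(gf a) -(gf b) !fh.
have [ab|ba] := ltP (\val a) (\val b); last first.
  exists 0, (\val (g a)) => x /andP[ax xb]; rewrite mul0r add0r.
  by congr (\val (g _)); apply/val_inj/le_anti; rewrite ax (le_trans xb ba).
have gab : \val (g a) <= \val (g b) by exact/gW/ltW.
have m0 : m != 0.
  apply/eqP => m0; move: ab; rewrite -[a]gf -[b]gf !fE ?lexx ?gab//.
  by rewrite m0 !mul0r ltxx.
exists m^-1, (- (m^-1 * c)) => x /andP[ax xb].
have xE : \val x = m * \val (g x) + c by rewrite -fE ?gf// !gW.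
by rewrite xE mulrDr mulKf// addrK.
Qed.

Definition PLo_one : PLo R := MkPLo (asboolT is_PLo_id).

Definition PLo_mul f g : PLo R :=
  MkPLo (asboolT (is_PLo_comp (PLoP f) (PLoP g))).

Lemma PLo_inv_ex f : exists g : PLo R, cancel f g /\ cancel g f.
Proof.
have [[_ [g [fg gf _]]] _ _] := PLoP f.
by exists (MkPLo (asboolT (is_PLo_inv (PLoP f) fg gf))).
Qed.

Definition PLo_inv f : PLo R := sval (cid (PLo_inv_ex f)).

Lemma PLo_invK f : cancel f (PLo_inv f).
Proof. by rewrite /PLo_inv; case: cid => g []. Qed.

Lemma PLo_invKV f : cancel (PLo_inv f) f.
Proof. by rewrite /PLo_inv; case: cid => g []. Qed.

Lemma PLo_mulA : associative PLo_mul.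
Proof. by move=> f g h; exact: PLo_ext. Qed.

Lemma PLo_mul1 : left_id PLo_one PLo_mul.
Proof. by move=> f; exact: PLo_ext. Qed.

Lemma PLo_mulr1 : right_id PLo_one PLo_mul.
Proof. by move=> f; exact: PLo_ext. Qed.

Lemma PLo_mulV : left_inverse PLo_one PLo_inv PLo_mul.
Proof. by move=> f; apply: PLo_ext => x; exact: PLo_invK. Qed.

Lemma PLo_mulrV : right_inverse PLo_one PLo_inv PLo_mul.
Proof. by move=> f; apply: PLo_ext => x; exact: PLo_invKV. Qed.

HB.instance Definition _ := isGroup.Build (PLo R)
  PLo_mulA PLo_mul1 PLo_mulr1 PLo_mulV PLo_mulrV.

End PLoGroup.

Lemma PLo_mulE (R : realType) (f g : PLo R) (x : unitI R) :
  (f * g)%g x = f (g x).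
Proof. by []. Qed.

(* Main.v *)
(* Two facts are combined. (A) A non-solvable group [H] contains iterated wreath
   products of every height: if [D] is a finitely generated subgroup of [H'], then
   [D] lies in [K'] for a finitely generated [K <= H]; since one-sided germs at a
   point fixed by [K] commute, the support of [D] has compact closure in the
   support of [K], and a counting argument yields one element [y] of [K] that
   moves the pieces of this support off themselves in all orbitals of [K] at
   once, so that [D] and [y] generate the wreath product of [D] by [Z].
   (B) Let [S] be solvable of derived length [n + 1] with a single orbital
   [(a, b)], and let [M] be its subgroup of elements that are trivial near [a] and
   near [b]. The displacement trick of (A) shows that [M] has derived length at
   most [n] and a fixed point in [(a, b)], and piecewise linearity shows that
   [S / M] is infinite cyclic; hence [S] embeds in the wreath product with [Z]
   of the restriction of [M] to a fundamental domain. Every element moves points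
   in finitely many of the countably many orbitals of a general [S], which costs
   one further wreath product. *)

Require Import Defs.
From mathcomp Require Import all_boot all_order all_algebra.
From mathcomp Require Import all_classical all_reals all_analysis.
From mathcomp Require Import lra ring zify.

Set Implicit Arguments.
Unset Strict Implicit.
Unset Printing Implicit Defensive.

Import Order.TTheory GRing.Theory Num.Theory.

Local Open Scope classical_set_scope.
Local Open Scope ring_scope.

(** * Subgroups and derived series *)

Section Subgroups.
Local Open Scope group_scope.
Variable G : groupType.
Implicit Types (A B : set G) (x y z : G).

Lemma subgroupP A : A 1 -> (forall x y, A x -> A y -> A (x * y)) ->
  (forall x, A x -> A x^-1) -> subgroup A.
Proof.
move=> A1 AM AV; split; first exact/mem_set.
by move=> x y /set_mem xA /set_mem yA; apply/mem_set/AM => //; exact: AV.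
Qed.

Lemma subgroup1 A : subgroup A -> A 1.
Proof. by move=> [/set_mem]. Qed.

Lemma subgroupV A x : subgroup A -> A x -> A x^-1.
Proof. by move=> /group_closedV gA Ax; apply/set_mem/gA/mem_set. Qed.

Lemma subgroupM A x y : subgroup A -> A x -> A y -> A (x * y).
Proof.
by move=> /group_closedM gA Ax Ay; apply/set_mem/gA; exact: mem_set.
Qed.

Lemma subgroupR A x y : subgroup A -> A x -> A y -> A [~ x, y].
Proof.
move=> gA Ax Ay; rewrite commgEl conjgE.
by do ![apply: subgroupM => //; try exact: subgroupV].
Qed.

Lemma subgroup_smallest A : subgroup (smallest (@subgroup G) A).
Proof.
apply: subgroupP => [|x y xA yA|x xA] B [gB AB].
- exact: subgroup1.
- by apply: subgroupM => //; [exact: xA|exact: yA].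
- by apply: subgroupV => //; exact: xA.
Qed.

Lemma subgroup_derived A : subgroup (derived_subgroup A).
Proof. exact: subgroup_smallest. Qed.

Lemma derived_comm A x y : A x -> A y -> derived_subgroup A [~ x, y].
Proof. by move=> Ax Ay; apply: sub_gen_smallest; exists x, y. Qed.

Lemma derived_min A B : subgroup B -> (forall x y, A x -> A y -> B [~ x, y]) ->
  derived_subgroup A `<=` B.
Proof.
by move=> gB AB; apply: smallest_sub => // _ [x [y [Ax Ay ->]]]; exact: AB.
Qed.

Lemma derived_sub A : subgroup A -> derived_subgroup A `<=` A.
Proof. by move=> gA; apply: derived_min => // x y; exact: subgroupR. Qed.

Lemma derivedS A B : A `<=` B -> derived_subgroup A `<=` derived_subgroup B.
Proof.
move=> AB; apply: derived_min; first exact: subgroup_derived.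
by move=> x y Ax Ay; apply: derived_comm; exact: AB.
Qed.

Lemma derived_seriesSr n A :
  derived_series n.+1 A = derived_series n (derived_subgroup A).
Proof. exact: iterSr. Qed.

Lemma derived_seriesS n A B :
  A `<=` B -> derived_series n A `<=` derived_series n B.
Proof. by move=> AB; elim: n => //= n IHn; exact: derivedS. Qed.

Lemma derived_series_sub n A : subgroup A -> derived_series n A `<=` A.
Proof.
move=> gA; elim: n => [//|n IHn] x; rewrite derived_seriesSr => Ax.
by apply: IHn; apply: derived_seriesS Ax; exact: derived_sub.
Qed.

(** The relation is a subgroup of [G * G], hence compatible with commutators. A relation is used
    because the partner in [B] need not depend multiplicatively on the element of [A]. *)
Lemma derived_relation (rho : G -> G -> Prop) A B n :
    rho 1 1 ->
    (forall x x' y y', rho x x' -> rho y y' -> rho (x * y) (x' * y')) ->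
    (forall x x', rho x x' -> rho x^-1 x'^-1) ->
    subgroup B -> (forall x, A x -> exists2 y, B y & rho x y) ->
  forall x, derived_series n A x -> exists2 y, derived_series n B y & rho x y.
Proof.
move=> rho1 rhoM rhoV; elim: n A B => [//|n IHn] A B gB AB x.
rewrite !derived_seriesSr; move: x; apply: (IHn (derived_subgroup A)).
  exact: subgroup_derived.
apply: derived_min.
  apply: subgroupP => [|x x' [y By xy] [y' By' xy']|x [y By xy]].
  - by exists 1 => //; apply: subgroup1; exact: subgroup_derived.
  - exists (y * y'); last exact: rhoM.
    exact: (subgroupM (subgroup_derived _)).
  - exists y^-1; last exact: rhoV.
    exact: (subgroupV (subgroup_derived _)).
move=> x x' /AB[y By xy] /AB[y' By' xy'].
exists [~ y, y']; first exact: derived_comm.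
rewrite /commg /conjg; apply: (rhoM); first exact: rhoV.
by apply: (rhoM); [exact: rhoV|exact: rhoM].
Qed.

(** Membership in a term of the derived series involves finitely many elements of [A], and
    directedness collects these in one [D k]. *)
Lemma derived_directed (I : Type) (i0 : I) (D : I -> set G) A n :
    (forall i j, exists k, D i `<=` D k /\ D j `<=` D k) ->
    (forall x, A x -> exists i, D i x) ->
  forall x, derived_series n A x -> exists i, derived_series n (D i) x.
Proof.
elim: n A D => [//|n IHn] A D Ddir AD x; rewrite derived_seriesSr.
move=> /(IHn _ (fun i => derived_subgroup (D i)))[||i Dix].
- move=> i j; have [k [ik jk]] := Ddir i j.
  by exists k; split; exact: derivedS.
- apply: derived_min.
    apply: subgroupP => [|y z [i Dy] [j Dz]|y [i Dy]].
    + by exists i0; exact: (subgroup1 (subgroup_derived _)).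
    + have [k [ik jk]] := Ddir i j; exists k.
      by apply: (subgroupM (subgroup_derived _)); [exact: derivedS Dy|
        exact: derivedS Dz].
    + by exists i; exact: (subgroupV (subgroup_derived _)).
  move=> y z /AD[i Diy] /AD[j Djz]; have [k [ik jk]] := Ddir i j.
  by exists k; apply: derived_comm; [exact: ik|exact: jk].
- by exists i; rewrite derived_seriesSr.
Qed.

Lemma nonsolvable_derived A :
  ~ is_solvable A -> ~ is_solvable (derived_subgroup A).
Proof.
by move=> nA [n nE]; apply: nA; exists n.+1; rewrite derived_seriesSr.
Qed.

(** * Finitely generated subgroups *)

Definition generated (l : seq G) : set G :=
  smallest (@subgroup G) [set x | x \in l].

Lemma subgroup_generated l : subgroup (generated l).
Proof. exact: subgroup_smallest. Qed.

Lemma mem_generated l x : x \in l -> generated l x.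
Proof. by move=> xl; apply: sub_gen_smallest. Qed.

Lemma generated_sub l A :
  subgroup A -> (forall x, x \in l -> A x) -> generated l `<=` A.
Proof. by move=> gA lA; exact: smallest_sub. Qed.

Lemma generated_derived A l : subgroup A ->
    (forall x, x \in l -> derived_subgroup A x) ->
  exists l', (forall x, x \in l' -> A x) /\
    generated l `<=` derived_subgroup (generated l').
Proof.
move=> gA; pose I : Type := {l' : seq G | forall x, x \in l' -> A x}.
pose D (i : I) := generated (sval i).
have i0 : I by exists [::].
have Ddir i j : exists k, D i `<=` D k /\ D j `<=` D k.
  have ijA x : x \in sval i ++ sval j -> A x.
    by rewrite mem_cat => /orP[/(svalP i)|/(svalP j)].
  exists (exist _ _ ijA); split; apply: generated_sub;
    try exact: subgroup_generated;
    by move=> x xl; apply: mem_generated; rewrite mem_cat xl ?orbT.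
have AD x : A x -> exists i, D i x.
  move=> Ax; have xA : forall y, y \in [:: x] -> A y.
    by move=> y; rewrite inE => /eqP->.
  by exists (exist _ _ xA); apply: mem_generated; rewrite inE.
have memD := derived_directed (n := 1) i0 Ddir AD.
move=> lA.
suff [k kl] : exists k, forall x, x \in l -> derived_subgroup (D k) x.
  exists (sval k); split; first exact: (svalP k).
  exact: (generated_sub (subgroup_derived _)).
elim: l lA => [|x l IHl] lA; first by exists i0.
have [y yl|k kl] := IHl; first by apply: lA; rewrite inE yl orbT.
have [j xj] : exists j, derived_subgroup (D j) x.
  by apply: memD; apply: lA; rewrite inE eqxx.
have [m [km jm]] := Ddir k j; exists m => y; rewrite inE => /orP[/eqP->|/kl].
  exact: derivedS xj.
exact: derivedS.
Qed.

(** * Integer powers *)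

Definition zexpg x (n : int) : G :=
  match n with Posz m => x ^+ m | Negz m => x ^- m.+1 end.

Lemma zexpg0 x : zexpg x 0 = 1.
Proof. by []. Qed.

Lemma zexpg1 x : zexpg x 1 = x.
Proof. by []. Qed.

Lemma zexpgS x n : zexpg x (1 + n)%R = x * zexpg x n.
Proof.
case: n => [n|[|n]].
- by rewrite -PoszD add1n /= expgS.
- by rewrite /= mulgV.
- rewrite (_ : (1 + Negz n.+1)%R = Negz n); last by rewrite !NegzE; lia.
  by rewrite /zexpg [in RHS]expgSr invgM mulVKg.
Qed.

Lemma zexpgP x n : zexpg x (n - 1)%R = x^-1 * zexpg x n.
Proof.
have nE : n = (1 + (n - 1))%R by rewrite addrC subrK.
by rewrite [in RHS]nE zexpgS mulKg.
Qed.

Lemma zexpgD x m n : zexpg x (m + n)%R = zexpg x m * zexpg x n.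
Proof.
elim/int_ind: m => [|m IHm|m IHm].
- by rewrite add0r mul1g.
- by rewrite -add1n PoszD -addrA !zexpgS IHm mulgA.
- rewrite (_ : (- m.+1%:Z = - m%:Z - 1)%R); last by lia.
  by rewrite addrAC !zexpgP IHm mulgA.
Qed.

Lemma zexpgSr x n : zexpg x (n + 1)%R = zexpg x n * x.
Proof. exact: zexpgD. Qed.

Lemma zexpgN x n : zexpg x (- n)%R = (zexpg x n)^-1.
Proof. by apply/esym/mulg1_eq; rewrite -zexpgD subrr. Qed.

Lemma zexpgV x n : zexpg x^-1 n = zexpg x (- n)%R.
Proof. by rewrite zexpgN; case: n => n /=; rewrite expVgn. Qed.

Lemma subgroupZ A x n : subgroup A -> A x -> A (zexpg x n).
Proof.
move=> gA Ax; elim/int_ind: n => [|n IHn|n IHn].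
- exact: subgroup1.
- by rewrite -add1n PoszD zexpgS; exact: subgroupM.
- rewrite (_ : (- n.+1%:Z = - n%:Z - 1)%R); last by lia.
  by rewrite zexpgP; apply: subgroupM => //; exact: subgroupV.
Qed.

Lemma subgroup_cyclic x : subgroup (range (zexpg x)).
Proof.
apply: subgroupP => [|_ _ [m _ <-] [n _ <-]|_ [m _ <-]].
- by exists 0%R.
- by exists (m + n)%R; rewrite ?zexpgD.
- by exists (- m)%R; rewrite ?zexpgN.
Qed.

End Subgroups.

(** * Action on the real line and germs *)

Section Action.
Variable R : realType.
Implicit Types (f g : PLo R) (S : set (PLo R)) (x y z : R).

(** Extension by the identity gives a map of the whole line, so that order and affine computations
    need no membership proofs. *)
Definition act f x : R :=
  if insub x is Some u then \val (f u) else x.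

Lemma act_val f (u : unitI R) : act f (\val u) = \val (f u).
Proof. by rewrite /act valK. Qed.

Lemma val_unitI (u : unitI R) : 0 <= \val u <= 1.
Proof. by case: u => u /= /set_mem; rewrite /= in_itv. Qed.

Lemma unitI_val x : 0 <= x <= 1 -> exists u : unitI R, x = \val u.
Proof.
move=> x01; have xI : x \in (`[0, 1]%classic : set R).
  by apply/mem_set; rewrite /= in_itv.
by exists (exist _ x xI).
Qed.

Lemma act_out f x : ~~ (0 <= x <= 1) -> act f x = x.
Proof.
move=> x01; rewrite /act; case: insubP => // u _ ux.
by move: x01; rewrite -ux val_unitI.
Qed.

Lemma act1g x : act 1%g x = x.
Proof.
have [/unitI_val[u ->]|x01] := boolP (0 <= x <= 1); first by rewrite act_val.
by rewrite act_out.
Qed.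

Lemma actM f g x : act (f * g)%g x = act f (act g x).
Proof.
have [/unitI_val[u ->]|x01] := boolP (0 <= x <= 1); first by rewrite !act_val.
by rewrite !act_out.
Qed.

Lemma actK f x : act f^-1%g (act f x) = x.
Proof. by rewrite -actM mulVg act1g. Qed.

Lemma actKV f x : act f (act f^-1%g x) = x.
Proof. by rewrite -actM mulgV act1g. Qed.

Lemma act_ext f g : (forall x, act f x = act g x) -> f = g.
Proof.
by move=> fg; apply: PLo_ext => u; apply: val_inj; rewrite -!act_val fg.
Qed.

Lemma act_homo f : {homo act f : x y / x < y}.
Proof.
move=> x y xy.
have [x01|x01] := boolP (0 <= x <= 1); have [y01|y01] := boolP (0 <= y <= 1).
- have [u xu] := unitI_val x01; have [v yv] := unitI_val y01.
  rewrite xu yv !act_val; have [_ fh _] := PLoP f; apply: fh.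
  by rewrite -xu -yv.
- have [u xu] := unitI_val x01; rewrite (act_out f y01) xu act_val.
  have /andP[_ fu1] := val_unitI (f u); apply: (le_lt_trans fu1).
  by rewrite ltNge; apply: contraNN y01 => y1; lra.
- have [u yu] := unitI_val y01; rewrite (act_out f x01) yu act_val.
  have /andP[fu0 _] := val_unitI (f u); apply: lt_le_trans fu0.
  by rewrite ltNge; apply: contraNN x01 => x0; lra.
- by rewrite !act_out.
Qed.

Lemma act_lt f : {mono act f : x y / x < y}.
Proof. by apply: leW_mono; apply: le_mono; exact: act_homo. Qed.

Lemma act_le f : {mono act f : x y / x <= y}.
Proof. by apply: le_mono; exact: act_homo. Qed.

Lemma act_inj f : injective (act f).
Proof. exact: can_inj (actK f). Qed.

Lemma act_fixV f x : act f x = x -> act f^-1%g x = x.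
Proof. by move=> fx; rewrite -[in LHS]fx actK. Qed.

Lemma act0 f : act f 0 = 0.
Proof.
have ge0 g : 0 <= act g 0.
  have [|u uE] := @unitI_val 0; first by lra.
  by rewrite [in leRHS]uE act_val; have /andP[] := val_unitI (g u).
by apply/le_anti; rewrite ge0 andbT -[X in _ <= X](actKV f) act_le.
Qed.

Lemma act1 f : act f 1 = 1.
Proof.
have le1 g : act g 1 <= 1.
  have [|u uE] := @unitI_val 1; first by lra.
  by rewrite [in leLHS]uE act_val; have /andP[] := val_unitI (g u).
by apply/le_anti; rewrite le1 -[X in X <= _](actKV f) act_le le1.
Qed.

Lemma act_affine f : exists B : seq R, forall a b : R,
  (forall x, x \in B -> ~~ (a < x < b)) ->
  exists m c : R, forall x, a <= x <= b -> act f x = m * x + c.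
Proof.
have [_ _ [B fB]] := PLoP f.
(* The extended map may also break at [0] and at [1]. *)
exists [:: 0, 1 & map val B] => a b abP.
have [ab|ba] := ltP a b; last first.
  exists 0, (act f a) => x /andP[ax xb]; rewrite mul0r add0r.
  by congr act; apply/le_anti; rewrite ax (le_trans xb ba).
have /abP n0 : 0 \in [:: 0, 1 & map val B] by rewrite inE eqxx.
have /abP n1 : 1 \in [:: 0, 1 & map val B] by rewrite !inE eqxx orbT.
have [b0|b0] := leP b 0.
  exists 1, 0 => x /andP[ax xb]; rewrite mul1r addr0.
  have [x0|x0] := ltP x 0; first by rewrite act_out//; lra.
  by rewrite (_ : x = 0) ?act0//; lra.
have [a1|a1] := leP 1 a.
  exists 1, 0 => x /andP[ax xb]; rewrite mul1r addr0.
  have [x0|x0] := ltP 1 x; first by rewrite act_out//; lra.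
  by rewrite (_ : x = 1) ?act1//; lra.
have a01 : 0 <= a <= 1.
  by rewrite (ltW a1) andbT leNgt; apply: contraNN n0 => ->.
have b01 : 0 <= b <= 1.
  by rewrite (ltW b0) leNgt; apply: contraNN n1 => ->; rewrite a1.
have [u au] := unitI_val a01; have [v bv] := unitI_val b01.
have [|m [c fE]] := fB u v.
  move=> w wB; rewrite -au -bv; apply: abP.
  by rewrite !inE map_f ?orbT.
exists m, c => x /andP[ax xb].
have [|w xw] := @unitI_val x; first by lra.
by rewrite xw act_val fE// -au -bv -xw ax.
Qed.

(* The sign [s] distinguishes the right germ ([s = 1]) from the left germ
   ([s = -1]) at [c]. *)
Definition germ (s c : R) f (m : R) :=
  exists2 e : R, 0 < e & forall X : R, 0 <= X <= e ->
    act f (c + s * X) = act f c + s * (m * X).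

Definition sign (s : R) := s = 1 \/ s = -1.

Lemma seq_gap (B : seq R) x : exists2 e : R, 0 < e &
  forall y, y \in B -> ~~ (x < y < x + e) && ~~ (x - e < y < x).
Proof.
elim: B => [|b B [e e0 eB]]; first by exists 1.
have [->|bx] := eqVneq b x.
  by exists e => // y; rewrite inE => /orP[/eqP->|/eB//]; rewrite ltxx andbF.
exists (Num.min e `|x - b|).
  by rewrite lt_min e0 normr_gt0 subr_eq0 eq_sym.
move=> y; rewrite inE => /orP[/eqP->|/eB/andP[/negP h1 /negP h2]].
  have : Num.min e `|x - b| <= `|x - b| by rewrite ge_min lexx orbT.
  set d := Num.min _ _; move: (d) => {}d.
  move=> db; apply/andP; split; apply/negP => yx; move: db.
    by rewrite ltr0_norm ?subr_lt0//; lra.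
  by rewrite gtr0_norm ?subr_gt0//; lra.
have : Num.min e `|x - b| <= e by rewrite ge_min lexx.
set d := Num.min _ _; move: (d) => {}d de.
by apply/andP; split; apply/negP => yx; [apply: h1|apply: h2]; lra.
Qed.

Lemma germ_ex s c f : sign s -> exists2 m : R, 0 < m & germ s c f m.
Proof.
move=> s1; have [B fB] := act_affine f.
have [e e0 eB] := seq_gap B c.
have [m [d fE]] : exists m d : R, forall X, 0 <= X <= e ->
    act f (c + s * X) = m * (c + s * X) + d.
  case: s1 => ->; [have [|m [d fE]] := fB c (c + e)|
    have [|m [d fE]] := fB (c - e) c].
  - by move=> x /eB/andP[].
  - by exists m, d => X X0e; rewrite fE//; lra.
  - by move=> x /eB/andP[].
  - by exists m, d => X X0e; rewrite fE//; lra.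
have fc : act f c = m * c + d by have := fE 0; rewrite mulr0 addr0; apply; lra.
exists m; last by exists e => // X X0e; rewrite fE// fc; ring.
have ee : act f (c + s * e) = m * (c + s * e) + d by apply: fE; lra.
rewrite -(pmulr_lgt0 _ e0); case: s1 => se; rewrite se in ee.
  have : act f c < act f (c + 1 * e) by rewrite act_lt; lra.
  by rewrite ee fc; lra.
have : act f (c + -1 * e) < act f c by rewrite act_lt; lra.
by rewrite ee fc; lra.
Qed.

Lemma germ_inj s c f m m' : sign s -> germ s c f m -> germ s c f m' -> m = m'.
Proof.
move=> s1 [e e0 fE] [e' e'0 fE'].
set d := Num.min e e'.
have d0 : 0 < d by rewrite lt_min e0.
have de : d <= e by rewrite ge_min lexx.
have de' : d <= e' by rewrite ge_min lexx orbT.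
have := fE d; rewrite fE'; last by lra.
move=> /(_ ltac:(lra)) h; apply: (mulIf (lt0r_neq0 d0)).
by case: s1 => sE; rewrite sE in h; lra.
Qed.

Lemma germ_id s c : germ s c 1%g 1.
Proof. by exists 1 => // X _; rewrite !act1g mul1r. Qed.

Lemma germM s c f g m n : 0 <= n -> act g c = c ->
  germ s c f m -> germ s c g n -> germ s c (f * g)%g (m * n).
Proof.
move=> n0 gc [e e0 fE] [e' e'0 gE].
exists (Num.min e' (e / (n + 1))).
  by rewrite lt_min e'0 divr_gt0//; lra.
move=> X; rewrite le_min => /and3P[X0 Xe' Xe].
rewrite !actM gE ?X0// gc fE ?mulrA// mulr_ge0//=.
rewrite ler_pdivlMr in Xe; last by lra.
by lra.
Qed.

Lemma germV s c f m : 0 < m -> act f c = c -> germ s c f m ->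
  germ s c f^-1%g m^-1.
Proof.
move=> m0 fc [e e0 fE]; exists (m * e); first exact: mulr_gt0.
move=> X /andP[X0 Xe].
have := fE (m^-1 * X); rewrite mulVKf ?lt0r_neq0// fc => <-.
  by rewrite actK act_fixV.
by rewrite mulr_ge0 ?invr_ge0 ?(ltW m0)//= ler_pdivrMl// mulrC.
Qed.

(** Slopes at a common fixed point multiply under composition, and multiplication in [R] is
    commutative. *)
Lemma germ_comm s c f g : sign s -> act f c = c -> act g c = c ->
  germ s c [~ f, g]%g 1.
Proof.
move=> s1 fc gc.
have [m m0 fm] := germ_ex c f s1; have [n n0 gn] := germ_ex c g s1.
have -> : 1 = m^-1 * (n^-1 * (m * n)) by field; lra.
apply: germM; rewrite ?actM ?gc ?fc ?act_fixV//.
- by rewrite !mulr_ge0// ?invr_ge0 ltW.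
- exact: germV.
apply: germM; rewrite ?actM ?gc ?fc//; first by rewrite mulr_ge0 ?ltW.
- exact: germV.
by apply: germM; rewrite ?ltW.
Qed.

Lemma sup_fix (A : set R) f : A !=set0 -> has_ubound A ->
    (forall x, A x -> A (act f x)) -> (forall x, A x -> A (act f^-1%g x)) ->
  act f (sup A) = sup A.
Proof.
move=> A0 Aub fA fVA.
have le g : (forall x, A x -> A (act g^-1%g x)) -> sup A <= act g (sup A).
  move=> gA; apply: ge_sup => // x Ax.
  by rewrite -(actKV g x) act_le; apply: ub_le_sup => //; exact: gA.
apply/le_anti; rewrite le// andbT -[X in _ <= X](actKV f) act_le.
by apply: le => x; rewrite invgK; exact: fA.
Qed.

End Action.

(** * Simultaneous displacement *)

Section Displacement.
Variable R : realType.
Implicit Types (f g k y : PLo R) (S K D : set (PLo R)) (x p q u v z : R).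

Definition fixed S x := forall f, S f -> act f x = x.

Definition unfixed S p q := forall x, p <= x <= q -> ~ fixed S x.

(** Otherwise [q] bounds the orbit of [p], and the supremum of this orbit is a common fixed point in
    [[p, q]]. *)
Lemma displace S p q : subgroup S -> p <= q -> unfixed S p q ->
  exists2 k, S k & q < act k p.
Proof.
move=> gS pq ufS; apply: contrapT => noS.
pose A := [set act k p | k in S].
have Aub : ubound A q.
  move=> _ [k Sk <-]; rewrite leNgt; apply/negP => qk; apply: noS.
  by exists k.
have Ap : A p by exists 1%g; [exact: subgroup1|exact: act1g].
apply: (ufS (sup A)).
  apply/andP; split; first by apply: ub_le_sup => //; exists q.
  by apply: ge_sup => //; exists p.
move=> f Sf; apply: sup_fix; [by exists p|by exists q|..].
  by move=> _ [k Sk <-]; exists (f * k)%g; [exact: subgroupM|rewrite actM].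
move=> _ [k Sk <-]; exists (f^-1 * k)%g; last by rewrite actM.
by apply: subgroupM => //; exact: subgroupV.
Qed.

Lemma fixed_sup S (A : set R) : subgroup S -> A !=set0 -> has_ubound A ->
  (forall x, A x -> fixed S x) -> fixed S (sup A).
Proof.
move=> gS A0 Aub AS f Sf; apply: sup_fix => // x Ax; first by rewrite AS.
by rewrite AS//; exact: subgroupV.
Qed.

Definition displaced y p q := q < act y p \/ act y q < p.

(** Positive powers of a map that pushes [[p, q]] beyond [q] keep it there. Negative powers reduce
    to this by exchanging the point and its image, leftward motion by passing to the inverse. *)
Lemma displaced_zexpg y p q n x : displaced y p q ->
  p <= x <= q -> p <= act (zexpg y n) x <= q -> n = 0.
Proof.
have pos f (m : nat) z : q < act f p -> p <= z <= q ->
    q < act (zexpg f m.+1) z.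
  move=> qf /andP[pz zq].
  elim: m => [|m IHm].
    by rewrite zexpg1; apply: (lt_le_trans qf); rewrite act_le.
  rewrite (_ : m.+2%:Z = 1 + m.+1%:Z) ?zexpgS ?actM; last by lia.
  by apply: (lt_trans qf); rewrite act_lt; lra.
have main f m z : q < act f p -> p <= z <= q ->
    p <= act (zexpg f m) z <= q -> m = 0.
  move=> qf pzq; case: m => [[//|m]|m] h.
    by have := pos f m z qf pzq; rewrite ltNge; case/andP: h => _ ->.
  have := pos f m _ qf h; rewrite NegzE zexpgN actKV ltNge.
  by case/andP: pzq => _ ->.
move=> [qy|yp] px pyx; first exact: main pyx.
have : - n = 0; last by lia.
apply: (main y^-1%g (- n) x) => //; last by rewrite zexpgV opprK.
by rewrite -(act_lt y) actKV.
Qed.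

(** A common fixed point [z] satisfies [act k z = z], so it lies on the same side of [act k u] as of
    [u]. *)
Lemma unfixed_hull S k u v : S k -> unfixed S u v ->
  unfixed S (Num.min u (act k u)) (Num.max v (act k v)).
Proof.
move=> Sk ufS z; rewrite ge_min le_max => /andP[uz zv] fz.
have := fz _ Sk => kz; rewrite -kz !act_le kz in uz zv.
by apply: (ufS z) => //; lra.
Qed.

Lemma expg_between f x i M : (i <= M)%N ->
  Num.min x (act (f ^+ M)%g x) <= act (f ^+ i)%g x
    <= Num.max x (act (f ^+ M)%g x).
Proof.
move=> iM; rewrite ge_min le_max.
have [xf|/ltW fx] := leP x (act f x).
  have mono : {homo (fun j => act (f ^+ j)%g x) : j k / (j <= k)%N >-> j <= k}.
    apply: homo_leq => [//|? ? ?|j]; first exact: le_trans.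
    by rewrite expgSr actM act_le.
  by rewrite (mono _ _ iM) -[X in X <= act _ _ ](act1g x) (mono 0) ?orbT.
have mono : {homo (fun j => act (f ^+ j)%g x) : j k / (j <= k)%N >-> k <= j}.
  apply: (@homo_leq _ _ (fun a b : R => b <= a)) => [//|b a c ba cb|j].
    exact: le_trans cb ba.
  by rewrite expgSr actM act_le.
by rewrite (mono _ _ iM) -[X in act _ _ <= X](act1g x) (mono 0) ?orbT.
Qed.

Definition inside (X : R * R) x := X.1 <= x <= X.2.

(* Under the uniform distribution on [Y], each point lands in each of the
   given intervals with probability at most [1 / M]. *)
Lemma spread S (Xs : seq (R * R)) M : subgroup S ->
    (forall X, X \in Xs -> X.1 <= X.2 /\ unfixed S X.1 X.2) -> (0 < M)%N ->
  exists Y : seq (PLo R), [/\ (0 < size Y)%N, forall y, y \in Y -> S y &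
    forall X x, X \in Xs ->
      (M * \sum_(y <- Y) inside X (act y x) <= size Y)%N].
Proof.
move=> gS + M0.
move sE: (size Xs) => s.
elim: s Xs sE => [|s IHs] [|X0 Xs] // => [_ _|[sE] ufXs].
  by exists [:: 1%g]; split=> // y; rewrite inE => /eqP->; exact: subgroup1.
have [uv0 ufX0] : X0.1 <= X0.2 /\ unfixed S X0.1 X0.2.
  by apply: ufXs; rewrite inE eqxx.
have [k Sk kX0] := displace gS uv0 ufX0.
have SX n : S (k ^+ n)%g by exact: (subgroupZ n gS Sk).
pose kM := ((k ^+ M)^-1)%g.
have SkM : S kM by exact: subgroupV.
(* By [expg_between] the hull of [X] contains every [k^-i X] with [i <= M]. *)
pose hull (X : R * R) :=
  (Num.min X.1 (act kM X.1), Num.max X.2 (act kM X.2)).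
have [X' /mapP[X XXs ->]|Y [Y0 YS YX]] :=
    IHs [seq hull X | X <- Xs] (etrans (size_map _ _) sE).
  have [] := ufXs X; first by rewrite inE XXs orbT.
  by move=> uv ufX; split; [rewrite /= ge_min le_max uv|exact: unfixed_hull].
exists [seq (k ^+ i * y)%g | i <- iota 0 M, y <- Y]; split.
- by rewrite size_allpairs size_iota muln_gt0 M0.
- move=> _ /allpairsP[[i y] /= [_ yY ->]].
  by apply: subgroupM => //; exact: YS.
move=> X x; rewrite inE size_allpairs size_iota big_allpairs_dep.
move=> /orP[/eqP->|XXs].
  (* For fixed [y], at most one [i] sends the point into [X0], because [k] displaces [X0]. *)
  rewrite leq_mul2l exchange_big/= -[X in (_ <= X)%N]sum1_size.
  apply/orP; right; apply: leq_sum => y _.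
  have [->//|[i0 i0M i0X]] :
      (\sum_(i <- iota 0 M) inside X0 (act (k ^+ i * y)%g x))%N = 0%N \/
      exists2 i, i \in iota 0 M & inside X0 (act (k ^+ i * y)%g x).
    have [/hasP[i iM iX]|/hasPn h] :=
      boolP (has (fun i => inside X0 (act (k ^+ i * y)%g x)) (iota 0 M)).
      by right; exists i.
    by left; rewrite big_seq big1// => i /h/negbTE->.
  rewrite (bigD1_seq i0) ?iota_uniq//= i0X.
  rewrite big1_seq// => i /andP[ii0 _]; case: (boolP (inside _ _)) => // iX.
  case/eqP: ii0.
  suff : i%:Z - i0%:Z = 0 by lia.
  apply: (@displaced_zexpg k X0.1 X0.2 _ (act (k ^+ i0 * y)%g x)) => //.
    by left.
  rewrite -actM zexpgD zexpgN !mulgA mulgVK//.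
(* For the other intervals, landing in [X] after [k^i] forces [act y x] into the hull of [X],
   whatever [i] is. *)
rewrite leq_mul2l; apply/orP; right.
apply: leq_trans (YX (hull X) x (map_f _ XXs)).
have -> : (M * \sum_(y <- Y) inside (hull X) (act y x) =
    \sum_(i <- iota 0 M) \sum_(y <- Y) inside (hull X) (act y x))%N.
  by rewrite big_const_seq count_predT size_iota iter_addn_0 mulnC.
rewrite [X in (X <= _)%N]big_seq [X in (_ <= X)%N]big_seq; apply: leq_sum => i.
rewrite mem_iota add0n => /andP[_ iM]; apply: leq_sum => y _.
case: (boolP (inside X _)) => // /andP[uy yv]; rewrite lt0b /inside /=.
have /andP[] := expg_between (k^-1)%g X.1 (ltnW iM).
have /andP[] := expg_between (k^-1)%g X.2 (ltnW iM).
rewrite !expVgn -/kM => _ le2 le1 _.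
have actV : act y x = act ((k ^+ i)^-1)%g (act (k ^+ i * y)%g x).
  by rewrite -actM mulKg.
apply/andP; split.
  by apply: (le_trans le1); rewrite actV act_le.
by apply: le_trans le2; rewrite actV act_le.
Qed.

(* For independent uniform [a] and [b] in [Y], the element [a b^-1] fails to
   displace a given interval with probability at most [2 / M]. *)
Lemma simultaneous_displacement S (Xs : seq (R * R)) : subgroup S ->
    (forall X, X \in Xs -> X.1 <= X.2 /\ unfixed S X.1 X.2) ->
  exists2 y, S y & forall X, X \in Xs -> displaced y X.1 X.2.
Proof.
(* There are two bad events per interval, each of probability at most [1 / M]; this [M] makes their
   total less than [1]. *)
move=> gS ufXs; pose M := (2 * size Xs).+1.
have [Y [Y0 YS YX]] := spread gS ufXs (ltn0Sn _ : (0 < M)%N).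
apply: contrapT => noy.
(* If [a b^-1] does not displace [X], then [X] and its image meet, so the left end of one lies in
   the other. *)
have bad a b : a \in Y -> b \in Y -> exists2 X, X \in Xs &
    inside X (act a (act b^-1%g X.1)) \/ inside X (act b (act a^-1%g X.1)).
  move=> /YS Sa /YS Sb; apply: contrapT => h; apply: noy.
  exists (a * b^-1)%g; first by apply: subgroupM => //; exact: subgroupV.
  move=> X XXs; apply: contrapT => nd; apply: h; exists X => //.
  have [XX _] := ufXs X XXs.
  have ab z : act (a * b^-1)%g z = act a (act b^-1%g z) by rewrite actM.
  have h1 : act a (act b^-1%g X.1) <= X.2.
    by rewrite leNgt -ab; apply/negP => ?; apply: nd; left.
  have h2 : X.1 <= act a (act b^-1%g X.2).
    by rewrite leNgt -ab; apply/negP => ?; apply: nd; right.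
  have [u1|/ltW u1] := leP X.1 (act a (act b^-1%g X.1)).
    by left; rewrite /inside u1.
  right; rewrite /inside; apply/andP; split.
    by rewrite -(act_le b^-1%g) actK -(act_le a) actKV.
  by rewrite -(act_le b^-1%g) actK -(act_le a) actKV.
pose T X := (\sum_(b <- Y) \sum_(a <- Y) inside X (act a (act b^-1%g X.1)))%N.
have MT X : X \in Xs -> (M * T X <= size Y * size Y)%N.
  move=> XXs; rewrite /T big_distrr /= -[X in (_ <= X * _)%N]sum1_size.
  by rewrite big_distrl/=; apply: leq_sum => b _; rewrite mul1n; exact: YX.
(* Every pair is bad for some [X]; exchanging [a] and [b] turns the second event into the first,
   whence [T X] twice. *)
have YT : (size Y * size Y <= \sum_(X <- Xs) (T X + T X))%N.
  rewrite big_split/= {2}/T [X in (_ <= _ + X)%N](eq_bigr (fun X : R * R =>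
    \sum_(a <- Y) \sum_(b <- Y) inside X (act b (act a^-1%g X.1)))%N); last first.
    by move=> X _; rewrite exchange_big.
  rewrite -big_split /T /=.
  rewrite (eq_bigr (fun X : R * R => \sum_(b <- Y) \sum_(a <- Y)
    (inside X (act a (act b^-1%g X.1)) + inside X (act b (act a^-1%g X.1))))%N);
    last first.
    move=> X _; rewrite [X in (_ + X)%N]exchange_big -big_split/=.
    by apply: eq_bigr => b _; rewrite -big_split.
  rewrite exchange_big/= -[X in (X * _ <= _)%N]sum1_size big_distrl/=.
  rewrite !big_seq; apply: leq_sum => b bY; rewrite mul1n exchange_big/=.
  rewrite -sum1_size !big_seq; apply: leq_sum => a aY.
  have [X XXs h] := bad a b aY bY.
  rewrite (big_rem X)//=; apply: leq_trans (leq_addr _ _).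
  by case: h => ->; rewrite ?leq_addr ?leq_addl// addn_gt0 ?orbT.
have : (M * (size Y * size Y) <= 2 * size Xs * (size Y * size Y))%N.
  apply: (leq_trans (leq_mul (leqnn M) YT)).
  rewrite big_distrr/= mulnAC -mulnA [X in (_ <= 2 * X)%N]mulnC.
  rewrite -[size Xs]sum1_size mulnCA !big_distrl /= [X in (_ <= X)%N]big_seq.
  rewrite big_seq; apply: leq_sum => X XXs; have := MT X XXs; nia.
rewrite leq_pmul2r ?muln_gt0 ?Y0// /M ltnn //.
Qed.

End Displacement.

(** * Displacing finitely generated subgroups of a derived subgroup *)

Section Displacing.
Variable R : realType.
Implicit Types (f g k y d : PLo R) (S K D H : set (PLo R)) (x p q u v z : R).

Lemma subgroup_germ1 s c : subgroup [set f : PLo R | act f c = c /\ germ s c f 1].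
Proof.
apply: subgroupP => [|f g [fc f1] [gc g1]|f [fc f1]] /=.
- by split; [exact: act1g|exact: germ_id].
- by split; [rewrite actM gc|rewrite -[1]mulr1; exact: germM].
- by split; [exact: act_fixV|rewrite -invr1; exact: germV].
Qed.

Lemma derived_germ1 K s c d : sign s -> fixed K c ->
  derived_subgroup K d -> act d c = c /\ germ s c d 1.
Proof.
move=> s1 Kc; have := @derived_min _ K _ (subgroup_germ1 s c).
apply=> f g /Kc fc /Kc gc; split; last exact: germ_comm.
by rewrite /commg /conjg !actM gc fc !act_fixV.
Qed.

Lemma germ1P s c f : act f c = c -> germ s c f 1 ->
  exists2 e : R, 0 < e & forall X : R, 0 <= X <= e ->
    act f (c + s * X) = c + s * X.
Proof. by move=> fc [e e0 fE]; exists e => // X /fE; rewrite fc mul1r. Qed.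

Lemma seq_max (Q : seq R) x : (exists2 p, p \in Q & p <= x) ->
  exists2 p, p \in Q & p <= x /\ forall r, r \in Q -> r <= x -> r <= p.
Proof.
elim: Q => [[//]|a Q IHQ] [p0 p0Q p0x].
have [[p pQ [px pmax]]|noQ] := pselect
    (exists2 p, p \in Q & p <= x /\ forall r, r \in Q -> r <= x -> r <= p).
  have [ap|pa] := leP a p.
    exists p; first by rewrite inE pQ orbT.
    by split=> // r; rewrite inE => /orP[/eqP->//|]; exact: pmax.
  have [ax|xa] := leP a x.
    exists a; first by rewrite inE eqxx.
    split=> // r; rewrite inE => /orP[/eqP->//|rQ rx].
    by apply: le_trans (ltW pa); exact: pmax.
  exists p; first by rewrite inE pQ orbT.
  split=> // r; rewrite inE => /orP[/eqP->|]; last exact: pmax.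
  by rewrite leNgt xa.
have noQ' r : r \in Q -> x < r.
  by move=> rQ; rewrite ltNge; apply/negP => rx; apply: noQ; apply: IHQ; exists r.
move: p0Q; rewrite inE => /orP[/eqP p0E|/noQ']; last by rewrite ltNge p0x.
exists a; first by rewrite inE eqxx.
split=> [|r]; first by rewrite -p0E.
by rewrite inE => /orP[/eqP->//|/noQ']; rewrite ltNge => /negbTE->.
Qed.

Lemma seq_min (Q : seq R) x : (exists2 p, p \in Q & x <= p) ->
  exists2 p, p \in Q & x <= p /\ forall r, r \in Q -> x <= r -> p <= r.
Proof.
move=> [p pQ xp]; have [|q /mapP[r rQ ->] [rx rmax]] :=
    @seq_max [seq - r | r <- Q] (- x).
  by exists (- p); [exact: map_f|rewrite lerN2].
exists r => //; split; first by rewrite -lerN2.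
by move=> t tQ xt; rewrite -lerN2; apply: rmax; rewrite ?map_f// lerN2.
Qed.

(* A fixed point of [K] in a segment between consecutive breakpoints of [d]
   forces [d] to be the identity on that segment, the germ of [d] being trivial
   there. *)
Lemma derived_cover K d : derived_subgroup K d ->
  exists Q : seq R, forall x, act d x <> x ->
    exists p q, [/\ p \in Q, q \in Q, p <= x <= q & unfixed K p q].
Proof.
move=> Kd; have [B dB] := act_affine d.
exists [:: 0, 1 & B] => x dx.
have /andP[x0 x1] : 0 <= x <= 1 by apply/negPn/negP => /(act_out d).
have [|p pQ [px pmax]] := @seq_max [:: 0, 1 & B] x.
  by exists 0 => //; rewrite inE eqxx.
have [|q qQ [xq qmin]] := @seq_min [:: 0, 1 & B] x.
  by exists 1 => //; rewrite !inE eqxx orbT.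
exists p, q; split; rewrite ?px// => z /andP[pz zq] Kz.
have [|m [c dE]] := dB p q.
  move=> r rB; apply/negP => /andP[pr rq].
  have rQ : r \in [:: 0, 1 & B] by rewrite !inE rB !orbT.
  have [rx|xr] := leP r x; first by have := pmax r rQ rx; lra.
  by have := qmin r rQ (ltW xr); lra.
have [dz _] := derived_germ1 (or_introl erefl : sign 1) Kz Kd.
have dxE : act d x = m * x + c by apply: dE; rewrite px.
have dzE : act d z = m * z + c by apply: dE; rewrite pz.
(* An affine map with two fixed points is the identity; the second one comes from the trivial germ
   at [z], on a side where [[p, q]] has room. *)
suff [y yz [ypq dy]] : exists2 y, y != z & p <= y <= q /\ act d y = y.
  have dyE := dE y ypq; apply: dx.
  have m1 : m = 1.
    have yz0 : y - z != 0 by rewrite subr_eq0.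
    by apply: (mulIf yz0); lra.
  by rewrite dxE m1; rewrite m1 in dzE; lra.
have [zlq|qz] := ltP z q.
  have [_ zd] := derived_germ1 (or_introl erefl : sign 1) Kz Kd.
  have [e e0 de] := germ1P dz zd.
  have X0 : 0 < Num.min e (q - z) by rewrite lt_min e0 subr_gt0.
  have Xe : Num.min e (q - z) <= e by rewrite ge_min lexx.
  have Xq : Num.min e (q - z) <= q - z by rewrite ge_min lexx orbT.
  set X := Num.min _ _ in X0 Xe Xq.
  exists (z + 1 * X); first by rewrite gt_eqF//; lra.
  by split; [lra|apply: de; rewrite ltW].
have [plz|zp] := ltP p z.
  have [_ zd] := derived_germ1 (or_intror erefl : sign (-1)) Kz Kd.
  have [e e0 de] := germ1P dz zd.
  have X0 : 0 < Num.min e (z - p) by rewrite lt_min e0 subr_gt0.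
  have Xe : Num.min e (z - p) <= e by rewrite ge_min lexx.
  have Xq : Num.min e (z - p) <= z - p by rewrite ge_min lexx orbT.
  set X := Num.min _ _ in X0 Xe Xq.
  exists (z + -1 * X); first by rewrite lt_eqF//; lra.
  by split; [lra|apply: de; rewrite ltW].
by case: dx; rewrite (_ : x = z)//; lra.
Qed.

(* [displacing D y] makes [D] and [y] generate the wreath product of [D] by an
   infinite cyclic group. *)
Definition displacing D y := exists C : set R, [/\ C !=set0,
  forall d x, D d -> ~ C x -> act d x = x &
  forall n x, C x -> C (act (zexpg y n) x) -> n = 0].

Lemma fixed_lt K k x z : fixed K z -> K k -> x < z -> act k x < z.
Proof. by move=> Kz Kk xz; rewrite -(Kz k Kk) act_lt. Qed.

Lemma fixed_gt K k x z : fixed K z -> K k -> z < x -> z < act k x.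
Proof. by move=> Kz Kk xz; rewrite -(Kz k Kk) act_lt. Qed.

(** By [derived_cover] finitely many intervals, each inside an orbital of a finitely generated [K],
    cover the support of [generated l]. Their union is [C], and simultaneous displacement provides
    [y]. *)
Lemma nonsolvable_displacing H (l : seq (PLo R)) : subgroup H ->
    ~ is_solvable H -> (forall f, f \in l -> derived_subgroup H f) ->
  exists l' y, [/\ forall f, f \in l' -> H f, generated l `<=` generated l',
    generated l' y & displacing (generated l) y].
Proof.
move=> gH nH lH'.
(* The point [x0] keeps [C] non-empty even when [generated l] is trivial. *)
have [h Hh [x0 hx0]] : exists2 h, H h & exists x, act h x <> x.
  apply: contrapT => noh; apply: nH; exists 0%N.
  apply/seteqP; split=> [h Hh|_ ->]; last exact: subgroup1.
  apply: act_ext => x; rewrite act1g; apply: contrapT => hx; apply: noh.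
  by exists h => //; exists x.
have [l1 [l1H ll1]] := generated_derived gH lH'.
pose K := generated (h :: l1).
have gK : subgroup K by exact: subgroup_generated.
have lK' : generated l `<=` derived_subgroup K.
  apply: subset_trans ll1 _; apply: derivedS.
  apply: generated_sub => // x xl1.
  by apply: mem_generated; rewrite inE xl1 orbT.
have [Q QP] : exists Q : seq R, forall d x, d \in l -> act d x <> x ->
    exists p q, [/\ p \in Q, q \in Q, p <= x <= q & unfixed K p q].
  have: forall d, d \in l -> derived_subgroup K d.
    by move=> d dl; apply: (lK' d); exact: mem_generated.
  elim: {lH' ll1 lK'} l => [_|d l IHl lK']; first by exists [::].
  have [|Q QP] := IHl; first by move=> e el; apply: (lK' e); rewrite inE el orbT.
  have [|Q' QP'] := @derived_cover K d; first by apply: (lK' d); rewrite inE eqxx.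
  exists (Q ++ Q') => e x; rewrite inE => /orP[/eqP->/QP'|el /(QP _ _ el)];
    by move=> [p [q [pQ qQ pxq pq]]]; exists p, q; rewrite !mem_cat pQ qQ ?orbT.
pose C : set R := [set x | exists p q,
  [/\ p \in x0 :: Q, q \in x0 :: Q, p <= x <= q & unfixed K p q]].
pose Xs := [seq X <- [seq (p, q) | p <- x0 :: Q, q <- x0 :: Q] |
  (X.1 <= X.2) && `[< unfixed K X.1 X.2 >]].
have [X|y Ky yP] := @simultaneous_displacement _ K Xs gK.
  by rewrite mem_filter => /andP[/andP[-> /asboolP]].
exists (h :: l1), y; split=> //.
- by move=> x; rewrite inE => /orP[/eqP->//|]; exact: l1H.
- by apply: subset_trans lK' _; exact: derived_sub.
exists C; split.
- exists x0; exists x0, x0; split; rewrite ?inE ?eqxx ?lexx// => x x0x Kx.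
  apply: hx0; rewrite (_ : x0 = x); last exact: le_anti.
  by apply: Kx; apply: mem_generated; rewrite inE eqxx.
- move=> d x ld Cx.
  suff: generated l `<=` [set e : PLo R | act e x = x] by apply.
  apply: generated_sub; first by apply: subgroupP => [|f g fx gx|f fx] /=;
    [exact: act1g|rewrite actM gx|exact: act_fixV].
  move=> e el /=; apply: contrapT => /(QP _ _ el)[p [q [pQ qQ pxq pq]]].
  by apply: Cx; exists p, q; rewrite !inE pQ qQ !orbT.
move=> n x [p [q [pQ qQ pxq pq]]] [p' [q' [pQ' qQ' pxq' pq']]].
have Kyn := subgroupZ n gK Ky; set x' := act _ x in pxq'.
have minQ : Num.min p p' \in x0 :: Q by rewrite minEle; case: ifP.
have maxQ : Num.max q q' \in x0 :: Q by rewrite maxEle; case: ifP.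
have XXs : (Num.min p p', Num.max q q') \in Xs.
  rewrite mem_filter; apply/andP; split; last by apply: allpairs_f.
  rewrite /= ge_min !le_max; apply/andP; split.
    by apply/orP; left; apply/orP; left; lra.
  (* A point and its image under [K] lie on the same side of [z], so a fixed point in the hull would
     lie in one of the two intervals. *)
  apply/asboolP => z; rewrite ge_min le_max => /andP[pz zq] Kz.
  have [zx|xz|zx] := ltgtP z x.
  - have := fixed_gt Kz Kyn zx; rewrite -/x' => zx'.
    by case/orP: pz => pz; [apply: (pq z)|apply: (pq' z)] => //; lra.
  - have := fixed_lt Kz Kyn xz; rewrite -/x' => zx'.
    by case/orP: zq => zq; [apply: (pq z)|apply: (pq' z)] => //; lra.
  - by apply: (pq z) => //; rewrite zx.
apply: (displaced_zexpg (yP _ XXs) (x := x)); rewrite /= ge_min le_max.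
  by case/andP: pxq => -> ->.
by case/andP: pxq' => -> ->; rewrite !orbT.
Qed.

End Displacing.

(** * Wreath products *)

Section Wreath.
Variable R : realType.
Implicit Types (s t d z : PLo R) (S D V : set (PLo R)) (x a b : R).

Section Spec.
Variables (D : set (PLo R)) (z : PLo R) (C : set R).
Hypothesis gD : subgroup D.
Hypothesis DC : forall d x, D d -> ~ C x -> act d x = x.
Hypothesis zC : forall n x, C x -> C (act (zexpg z n) x) -> n = 0.

(* [g] is the infinite product of the pairwise commuting conjugates
   [z^j (f j) z^-j], characterised by its action on the disjoint translates
   [z^j C]. *)
Definition wreath_base (f : int -> PLo R) (g : PLo R) :=
  (forall j x, C x -> act g (act (zexpg z j) x) = act (zexpg z j) (act (f j) x))
  /\ (forall x, (forall j, ~ C (act (zexpg z j) x)) -> act g x = x).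

Lemma displacing_stable d x : D d -> C x -> C (act d x).
Proof.
move=> Dd Cx; apply: contrapT => nC.
have dx := act_inj (DC Dd nC).
by apply: nC; rewrite dx.
Qed.

Lemma zexpg_act m n x :
  act (zexpg z m) (act (zexpg z n) x) = act (zexpg z (m + n)) x.
Proof. by rewrite zexpgD actM. Qed.

Lemma wreath_baseP x : (exists j w, C w /\ x = act (zexpg z j) w) \/
  (forall j, ~ C (act (zexpg z j) x)).
Proof.
have [[j Cj]|noj] := pselect (exists j, C (act (zexpg z j) x)).
  left; exists (- j), (act (zexpg z j) x); split=> //.
  by rewrite zexpg_act addNr act1g.
by right=> j Cj; apply: noj; exists j.
Qed.

Lemma wreath_base_uniq f g g' : wreath_base f g -> wreath_base f g' -> g = g'.
Proof.
move=> [gC gn] [gC' gn']; apply: act_ext => x.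
by have [[j [w [Cw ->]]]|nC] := wreath_baseP x; rewrite ?gC ?gC' ?gn ?gn'.
Qed.

Lemma wreath_base1 f : (forall j, f j = 1%g) -> wreath_base f 1%g.
Proof. by move=> f1; split=> [j x _|x _]; rewrite ?f1 !act1g. Qed.

Lemma wreath_baseM f f' g g' : (forall j, D (f' j)) ->
    wreath_base f g -> wreath_base f' g' ->
  wreath_base (fun j => f j * f' j)%g (g * g')%g.
Proof.
move=> f'D [gC gn] [gC' gn']; split=> [j x Cx|x nC]; last first.
  by rewrite actM gn' ?gn.
rewrite !actM gC' ?gC//; exact: displacing_stable.
Qed.

(** Conjugation by [z^e] carries the factor at [j - e] to the factor at [j], as the cyclic group
    does in a wreath product. *)
Lemma wreath_base_shift f g e : wreath_base f g ->
  wreath_base (fun j => f (j - e)) (zexpg z e * g * zexpg z (- e))%g.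
Proof.
move=> [gC gn]; split=> [j x Cx|x nC]; rewrite !actM.
  by rewrite zexpg_act gC ?zexpg_act; [congr (act (zexpg _ _) (act (f _) _)); lia|].
by rewrite gn ?zexpg_act ?subrr ?act1g// => j; rewrite zexpg_act.
Qed.

Lemma wreath_base_ex V f (l : seq int) : subgroup V -> D `<=` V -> V z ->
    (forall j, D (f j)) -> (forall j, j \notin l -> f j = 1%g) ->
  exists2 g, V g & wreath_base f g.
Proof.
move=> gV DV Vz; elim: l f => [|j l IHl] f fD fl.
  by exists 1%g; [exact: subgroup1|apply: wreath_base1 => j; exact: fl].
(* The coordinate [j] is erased for the induction; the factor put back at [j] acts trivially on the
   other translates of [C] by [zC]. *)
pose f' i := if i == j then 1%g else f i.
have D1 : D 1%g by exact: subgroup1.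
have [i|i il|g Vg [gC gn]] := IHl f'; rewrite /f'.
- by case: ifP.
- by case: ifP => // ij; apply: fl; rewrite inE ij.
exists (zexpg z j * f j * zexpg z (- j) * g)%g.
  apply: subgroupM => //; apply: subgroupM => //; last exact: subgroupZ.
  by apply: subgroupM => //; [exact: subgroupZ|exact: DV].
split=> [i x Cx|x nC]; rewrite !actM; last first.
  by rewrite gn// (DC (fD j))// zexpg_act subrr act1g.
rewrite gC// /f'; case: eqVneq => [->|ij].
  by rewrite zexpg_act addNr !act1g.
rewrite zexpg_act (DC (fD j)) ?zexpg_act; first by congr (act (zexpg _ _) _); lia.
move=> /(zC (displacing_stable (fD i) Cx)); apply/eqP.
by rewrite addrC subr_eq0.
Qed.

End Spec.

(** The equations on [e] and [f] say that [s] goes to [(f s, e s)] homomorphically in the restricted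
    wreath product of [D] by the integers, which [displacing] realises inside [V]. *)
Lemma wreath_hom D z V S (e : PLo R -> int) (f : PLo R -> int -> PLo R) :
    subgroup D -> displacing D z -> subgroup V -> D `<=` V -> V z ->
    subgroup S ->
    (forall s j, S s -> D (f s j)) ->
    (forall s, S s -> exists l : seq int, forall j, j \notin l -> f s j = 1%g) ->
    (forall s t, S s -> S t -> e (s * t)%g = e s + e t) ->
    (forall s t j, S s -> S t -> f (s * t)%g j = (f s j * f t (j - e s))%g) ->
  exists phi : PLo R -> PLo R, [/\ forall s, S s -> V (phi s),
    forall s t, S s -> S t -> phi (s * t)%g = (phi s * phi t)%g &
    forall s, S s -> (phi s = 1%g <-> e s = 0 /\ forall j, f s j = 1%g)].
Proof.
move=> gD [C [[x0 Cx0] DC zC]] gV DV Vz gS fD fl eM fM.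
have ex s : exists g, S s -> V g /\ wreath_base z C (f s) g.
  have [Ss|] := pselect (S s); last by exists 1%g.
  have [l ls] := fl s Ss.
  have [|g Vg gf] := wreath_base_ex gD DC zC gV DV Vz (f := f s) _ ls.
    by move=> j; exact: fD.
  by exists g.
pose g s := sval (cid (ex s)).
have gV' s : S s -> V (g s) by rewrite /g; case: cid => h /= /[apply] -[].
have gP s : S s -> wreath_base z C (f s) (g s).
  by rewrite /g; case: cid => h /= /[apply] -[].
exists (fun s => g s * zexpg z (e s))%g; split.
- by move=> s Ss; apply: subgroupM => //; [exact: gV'|exact: subgroupZ].
- move=> s t Ss St; have Sst := subgroupM gS Ss St.
  have := wreath_baseM DC (fun j => fD t (j - e s) St) (gP s Ss)
    (wreath_base_shift (e s) (gP t St)).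
  move=> gst; have {}gst : wreath_base z C (f (s * t)%g)
      (g s * (zexpg z (e s) * g t * zexpg z (- e s)))%g.
    have fE : f (s * t)%g = fun j => (f s j * f t (j - e s))%g.
      by apply/funext => j; exact: fM.
    by rewrite fE.
  rewrite (wreath_base_uniq (gP _ Sst) gst) eM// zexpgD -!mulgA.
  by rewrite zexpgN mulKg.
move=> s Ss; have [gC gn] := gP s Ss; split=> [g1|[e0 f1]]; last first.
  rewrite e0 zexpg0 mulg1.
  exact: (wreath_base_uniq (gP s Ss) (wreath_base1 z C f1)).
(* The base element maps [x0] into [C], and by [g1] this image is [z^(- e s) x0]; so [zC]
   applies. *)
have e0 : e s = 0.
  have := congr1 (fun h => act h (act (zexpg z (- e s)) x0)) g1.
  rewrite /= act1g actM zexpg_act subrr -[act _ x0]/(act 1%g x0) act1g.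
  rewrite -[x0 in LHS](act1g x0) -(zexpg0 z) gC// act1g.
  move=> h; apply/eqP; rewrite -oppr_eq0; apply/eqP; apply: (zC _ x0) => //.
  by rewrite -h; exact: (displacing_stable DC (fD s 0 Ss)).
move: g1; rewrite e0 zexpg0 mulg1 => g1; split=> // j.
apply: act_ext => x; rewrite act1g.
have [Cx|nCx] := pselect (C x); last by apply: DC => //; exact: fD.
by have := gC j x Cx; rewrite g1 act1g => /act_inj.
Qed.

Definition trivial_on (s : PLo R) a b := forall x, a <= x <= b -> act s x = x.

(** A universality property: one [D] receives all groups acting on some [[a, b]] with derived length
    at most [n]. Prescribing the kernel allows [S] to act arbitrarily outside [[a, b]]. *)
Definition hosts n D := forall S a b, subgroup S -> fixed S a -> fixed S b ->
    (forall s, derived_series n S s -> trivial_on s a b) ->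
  exists phi : PLo R -> PLo R, [/\ forall s, S s -> D (phi s),
    forall s t, S s -> S t -> phi (s * t)%g = (phi s * phi t)%g &
    forall s, S s -> (phi s = 1%g <-> trivial_on s a b)].

Lemma hosts0 D : subgroup D -> hosts 0 D.
Proof.
move=> gD S a b gS Sa Sb Str; exists (fun=> 1%g); split.
- by move=> *; exact: subgroup1.
- by move=> *; rewrite mulg1.
- by move=> s Ss; split=> // _; exact: Str.
Qed.

End Wreath.

(** * Solvable groups with a single orbital *)

Section Descent.
Variable R : realType.
Implicit Types (f g s t y : PLo R) (T G M : set (PLo R)) (x u v a b : R).

Definition trivial_ends s a b := germ 1 a s 1 /\ germ (-1) b s 1.

Lemma trivial_endsP s a b : a < b -> act s a = a -> act s b = b ->
    trivial_ends s a b ->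
  exists u v, [/\ a < u, u < v, v < b &
    forall x, a <= x <= u \/ v <= x <= b -> act s x = x].
Proof.
move=> ab sa sb [/(germ1P sa)[e e0 sE] /(germ1P sb)[e' e'0 sE']].
have [d [d0 de de' dab]] :
    exists d, [/\ 0 < d, d <= e, d <= e' & 2 * d < b - a].
  exists (Num.min (Num.min e e') ((b - a) / 3)); split.
  - by rewrite !lt_min e0 e'0 divr_gt0// subr_gt0.
  - by rewrite !ge_min lexx.
  - by rewrite !ge_min lexx orbT.
  - have : Num.min (Num.min e e') ((b - a) / 3) <= (b - a) / 3.
      by rewrite ge_min lexx orbT.
    lra.
exists (a + d), (b - d); split; [lra|lra|lra|move=> x [] xI].
  by rewrite (_ : x = a + 1 * (x - a)) ?sE//; [lra|ring].
by rewrite (_ : x = b + -1 * (b - x)) ?sE'//; [lra|ring].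
Qed.

(* If [d] is supported in [[u, v]] and [y] pushes [[u, v]] off itself, then
   [[d^-1, y]] agrees with [d] on [[u, v]]; hence [T'] sees every compactly
   supported part of [G]. *)
Lemma derived_descent G T a b r : a < b -> subgroup G -> subgroup T ->
    G `<=` T -> fixed T a -> fixed T b ->
    (forall g, G g -> trivial_ends g a b) ->
    (forall u v, a < u < b -> a < v < b -> exists2 y, T y & v < act y u) ->
    (forall s, derived_series r.+1 T s -> trivial_on s a b) ->
  forall s, derived_series r G s -> trivial_on s a b.
Proof.
move=> ab gG gT GT Ta Tb Gab Tdisp Ttr s Gs.
pose P (uv : R * R) := [/\ a < uv.1, uv.1 < uv.2 & uv.2 < b].
pose I : Type := {uv : R * R | P uv}.
pose D (i : I) := [set g | G g /\
  forall x, a <= x <= (sval i).1 \/ (sval i).2 <= x <= b -> act g x = x].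
have gD i : subgroup (D i).
  apply: subgroupP => [|f g [Gf f1] [Gg g1]|f [Gf f1]].
  - by split; [exact: subgroup1|move=> x _; exact: act1g].
  - split; first exact: subgroupM.
    by move=> x xi; rewrite actM g1 ?f1.
  - by split; [exact: subgroupV|move=> x xi; apply/act_fixV/f1].
have i0 : I.
  by exists ((2 * a + b) / 3, (a + 2 * b) / 3); split => /=; lra.
have Ddir i j : exists k : I, D i `<=` D k /\ D j `<=` D k.
  case: i j => [[u v] /= [au uv vb]] [[u' v'] /= [au' uv' vb']].
  have kP : P (Num.min u u', Num.max v v').
    by rewrite /P /= lt_min au au' gt_max vb vb' gt_min !lt_max uv.
  exists (exist _ _ kP); split=> g [Gg g1]; split=> // x /=;
    rewrite le_min ge_max => -[] xI; apply: g1 => /=; lra.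
have GD g : G g -> exists i, D i g.
  move=> Gg; have [||u [v [au uv vb g1]]] := trivial_endsP ab _ _ (Gab g Gg).
  - by apply: Ta; exact: GT.
  - by apply: Tb; exact: GT.
  have iP : P (u, v) by [].
  by exists (exist _ _ iP).
have [i Ds] := derived_directed i0 Ddir GD Gs.
have [_ s1] := derived_series_sub (gD i) Ds.
case: i Ds s1 => -[u v] iP Ds /= s1; have [/= au uv vb] := iP.
have [||y Ty yuv] := Tdisp u v; [lra|lra|].
(* Fixing [u] and [v] makes agreement on [[u, v]] stable under products and inverses. *)
pose rho f g := [/\ act f u = u, act f v = v &
  forall x, u <= x <= v -> act f x = act g x].
have [|||||t Tt [_ _ st]] := @derived_relation _ rho _ (derived_subgroup T) r
    _ _ _ _ _ s Ds.
- by split; rewrite ?act1g.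
- move=> f f' g g' [fu fv ff'] [gu gv gg'].
  split; rewrite ?actM ?gu ?gv// => x xuv; rewrite !actM -gg'// ff'//.
  by rewrite -gu -gv !act_le.
- move=> f f' [fu fv ff']; split; [exact: act_fixV|exact: act_fixV|].
  move=> x xuv; apply: (act_inj (f := f')); rewrite actKV -ff' ?actKV//.
  by rewrite -(act_le f u) -(act_le f _ v) actKV fu fv.
- exact: subgroup_derived.
- move=> d [Gd d1]; exists [~ d^-1, y]%g.
    by apply: derived_comm => //; apply: subgroupV => //; exact: GT.
  split; [by apply: d1 => /=; lra|by apply: d1 => /=; lra|].
  move=> x xuv; rewrite /commg /conjg invgK !actM (act_fixV (f := d)) ?actK//.
  apply: d1 => /=; right; apply/andP; split.
    by apply: (le_trans (ltW yuv)); rewrite act_le; lra.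
  by rewrite -(Tb y Ty) act_le; lra.
move=> x /andP[ax xb].
have [xu|ux] := leP x u; first by apply: s1 => /=; left; rewrite ax.
have [vx|xv] := leP v x; first by apply: s1 => /=; right; rewrite vx.
rewrite st; last by rewrite !ltW.
by apply: Ttr; rewrite ?derived_seriesSr ?ax.
Qed.

(** Without such a point [M] displaces compact subintervals of [(a, b)], and [derived_descent] with
    [G = T = M] lowers [r] to [0]; then [M] is trivial on [[a, b]], a contradiction. *)
Lemma fixed_ex M a b r : a < b -> subgroup M -> fixed M a -> fixed M b ->
    (forall g, M g -> trivial_ends g a b) ->
    (forall s, derived_series r M s -> trivial_on s a b) ->
  exists2 x, a < x < b & fixed M x.
Proof.
move=> ab gM Ma Mb Mab Mtr; apply: contrapT => nofix.
have {}nofix x : a < x < b -> ~ fixed M x.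
  by move=> xab Mx; apply: nofix; exists x.
have Mdisp u v : a < u < b -> a < v < b -> exists2 y, M y & v < act y u.
  move=> uab vab; have [||y My yu] := @displace _ M u (Num.max u v) gM.
  - by rewrite le_max lexx.
  - move=> x; rewrite le_max => /andP[ux xuv]; apply: nofix.
    by case/orP: xuv => xuv; lra.
  - by exists y => //; apply: le_lt_trans yu; rewrite le_max lexx orbT.
have M0 : forall s, M s -> trivial_on s a b.
  elim: r Mtr => [//|r IHr] Mtr; apply: IHr.
  by apply: derived_descent Mtr.
apply: (nofix ((a + b) / 2)) => [|f Mf]; first by lra.
by apply: M0 => //; lra.
Qed.

End Descent.

Definition int_range (i k : int) :=
  [seq i + l%:Z | l <- iota 0 (absz (k - i)).+1].

Lemma mem_int_range (i j k : int) : i <= j -> j <= k -> j \in int_range i k.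
Proof.
move=> ij jk; apply/mapP; exists (absz (j - i)); last by lia.
by rewrite mem_iota; lia.
Qed.


(** * Structure of a solvable group on one orbital *)

Section Orbital.
Variable R : realType.
Implicit Types (f g k m s t y : PLo R) (D V : set (PLo R)) (x p q u v w z : R).

(** An intermediate value theorem by order alone: [A] is stable under [f] and its inverse, so
    [sup_fix] applies. *)
Lemma crossing f z x : z < x -> z < act f z -> act f x < x ->
  exists2 w, z <= w <= x & act f w = w.
Proof.
move=> zx fz fx; pose A := [set w | w <= x /\ w <= act f w].
have Az : A z by split; exact: ltW.
have Aub : has_ubound A by exists x => w [].
exists (sup A).
  rewrite (ub_le_sup Aub Az)/=; apply: ge_sup => [|w []//]; by exists z.
apply: sup_fix => [||w [wx wf]|w [wx wf]] //; first by exists z.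
  by split; [apply: (le_trans _ (ltW fx)); rewrite act_le|rewrite act_le].
have fw : act f^-1%g w <= w by rewrite -(act_le f) actKV.
by split; [exact: le_trans wx|rewrite actKV].
Qed.

Lemma small_pos (e c : R) : 0 < e -> 0 < c ->
  exists d : R, [/\ 0 < d, d <= e & d < c].
Proof.
move=> e0 c0; exists (Num.min e (c / 2)); split.
- by rewrite lt_min e0 divr_gt0.
- by rewrite ge_min lexx.
- by rewrite gt_min orbC; apply/orP; left; lra.
Qed.

(** For [0 < t <= 1] one has [(1 + t)^3 <= 1 + 7 t], whence the divisor [7]. *)
Lemma cube_root_gt1 (c : R) : 1 < c -> exists2 rho : R, 1 < rho & rho ^+ 3 <= c.
Proof.
move=> c1; have c7 : 0 < (c - 1) / 7 by rewrite divr_gt0// subr_gt0.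
have [t [t0 t1 tc]] := small_pos (ltr01 : 0 < 1 :> R) c7.
exists (1 + t); first by rewrite ltrDl.
by rewrite !exprS expr0; nra.
Qed.

Lemma act_fixZ f n x : act f x = x -> act (zexpg f n) x = x.
Proof.
move=> fx; elim/int_ind: n => [|n IHn|n IHn]; first exact: act1g.
  by rewrite -add1n PoszD zexpgS actM IHn.
rewrite (_ : - n.+1%:Z = - n%:Z - 1); last by lia.
by rewrite zexpgP actM IHn act_fixV.
Qed.

Lemma expr_unbounded (c B : R) : 1 < c -> exists n, B <= c ^+ n.
Proof.
move=> c1; have bern n : 1 + n%:R * (c - 1) <= c ^+ n.
  elim: n => [|n IHn]; first by rewrite mul0r addr0.
  rewrite exprS -natr1; have n0 : 0 <= n%:R :> R by [].
  have : c * (1 + n%:R * (c - 1)) <= c * c ^+ n by rewrite ler_pM2l//; lra.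
  have : 0 <= n%:R * (c - 1) * (c - 1) by rewrite !mulr_ge0//; lra.
  lra.
have c0 : 0 < c - 1 by lra.
have [B0|B0] := leP 0 (B / (c - 1)); last first.
  by exists 0%N; move: B0; rewrite ltr_pdivrMr// mul0r expr0; lra.
exists (Num.bound (B / (c - 1))); apply: le_trans (bern _).
have := archi_boundP B0; rewrite ltr_pdivrMr//; lra.
Qed.

Lemma expr_small (c X e : R) : 0 < c -> c < 1 -> 0 < e ->
  exists n, c ^+ n * X <= e.
Proof.
move=> c0 c1 e0; have ci : 1 < c^-1 by rewrite invf_gt1.
have [n Xe] := expr_unbounded (X / e) ci; exists n.
rewrite -ler_pdivlMl ?exprn_gt0// -exprVn mulrC.
by rewrite ler_pdivrMr// in Xe; rewrite mulrC.
Qed.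

(* The germ of [y] at [c] is a contraction linear up to distance [e]: conjugating
   by powers of [y] shows that [k] is linear up to distance [e] on the points
   where it commutes with [y], however short the linear germ of [k] is. *)
Lemma scaling (sg c : R) y k (mu nu e X : R) :
    act y c = c -> act k c = c -> 0 < mu -> mu < 1 ->
    (forall X : R, 0 <= X <= e -> act y (c + sg * X) = c + sg * (mu * X)) ->
    germ sg c k nu ->
    (forall n, act k (act (y ^+ n)%g (c + sg * X)) =
               act (y ^+ n)%g (act k (c + sg * X))) ->
    0 <= X <= e -> 0 <= nu * X <= e ->
  act k (c + sg * X) = c + sg * (nu * X).
Proof.
move=> yc kc mu0 mu1 yE [d d0 kE] com Xe nuXe.
have ynE n Z : 0 <= Z <= e ->
    act (y ^+ n)%g (c + sg * Z) = c + sg * (mu ^+ n * Z).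
  move=> Ze; elim: n => [|n IHn]; first by rewrite act1g mul1r.
  rewrite expgS actM IHn yE ?exprS ?mulrA//.
  case/andP: Ze => Z0 Ze; rewrite mulr_ge0 ?exprn_ge0 ?(ltW mu0)//=.
  by apply: le_trans Ze; rewrite ler_piMl ?exprn_ile1 ?(ltW mu0) ?(ltW mu1).
have [n nX] := expr_small X mu0 mu1 d0.
apply: (act_inj (f := (y ^+ n)%g)); rewrite -com !ynE// kE ?kc.
  by rewrite (mulrCA nu).
by rewrite nX mulr_ge0 ?exprn_ge0 ?(ltW mu0)//; lra.
Qed.

Variables (S : set (PLo R)) (a b : R) (r : nat).
Hypotheses (ab : a < b) (gS : subgroup S) (Sa : fixed S a) (Sb : fixed S b).
Hypothesis Sfix : forall x, a < x < b -> ~ fixed S x.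
Hypothesis Str : forall s, derived_series r S s -> trivial_on s a b.

(** This is the kernel of the homomorphism from [S] to the pair of slopes at [a] and [b], so it is
    normal with abelian quotient. *)
Let M := [set s | S s /\ trivial_ends s a b].

Let gM : subgroup M.
Proof.
have ga := subgroup_germ1 (1 : R) a; have gb := subgroup_germ1 (-1 : R) b.
apply: subgroupP => [|s t [Ss [sa sb]] [St [ta tb]]|s [Ss [sa sb]]].
- by split; [exact: subgroup1|split; exact: germ_id].
- split; first exact: subgroupM.
  have [_ ha] := subgroupM ga (conj (Sa Ss) sa) (conj (Sa St) ta).
  by have [_ hb] := subgroupM gb (conj (Sb Ss) sb) (conj (Sb St) tb); split.
- split; first exact: subgroupV.
  have [_ ha] := subgroupV ga (conj (Sa Ss) sa).
  by have [_ hb] := subgroupV gb (conj (Sb Ss) sb); split.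
Qed.

Let MS : M `<=` S. Proof. by move=> s []. Qed.

Let MR s t : S s -> S t -> M [~ s, t]%g.
Proof.
move=> Ss St; split; first exact: subgroupR.
by split; apply: germ_comm; rewrite ?Sa ?Sb//; [left|right].
Qed.

Let MJ m s : M m -> S s -> M (s^-1 * m * s)%g.
Proof.
move=> Mm Ss; rewrite -mulgA -[X in M X]/(m ^ s)%g.
rewrite (_ : m ^ s = m * [~ m, s])%g; last by rewrite commgEl mulVKg.
by apply: (subgroupM gM) => //; apply: MR => //; exact: MS.
Qed.

Lemma orbital_in s x : S s -> a < x < b -> a < act s x < b.
Proof. by move=> Ss; rewrite -{2}(Sa Ss) -{2}(Sb Ss) !act_lt. Qed.

Lemma orbital_gt w c : a < w < b -> a < c < b -> exists2 t, S t & c < act t w.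
Proof.
move=> wab cab; have [||t St tw] := @displace _ S w (Num.max w c) gS.
- by rewrite le_max lexx.
- move=> x; rewrite le_max => /andP[wx xwc]; apply: Sfix.
  by case/orP: xwc; lra.
- by exists t => //; apply: le_lt_trans tw; rewrite le_max lexx orbT.
Qed.

Lemma orbital_lt w c : a < w < b -> a < c < b -> exists2 t, S t & act t w < c.
Proof.
move=> wab cab; have [t St tc] := orbital_gt cab wab.
by exists t^-1%g; [exact: subgroupV|rewrite -(act_lt t) actKV].
Qed.

Let Mfix : exists2 x, a < x < b & fixed M x.
Proof.
apply: (fixed_ex (r := r) ab gM) => [s /MS|s /MS|s []|s Ms] //.
- exact: Sa.
- exact: Sb.
- by apply: Str; exact: derived_seriesS Ms.
Qed.

Let fixedM_act s x : S s -> fixed M x -> fixed M (act s x).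
Proof.
move=> Ss Mx m Mm; have := Mx _ (MJ Mm Ss); rewrite !actM => h.
by rewrite -[in RHS]h actKV.
Qed.

Let fixedM_comm s t x : S s -> S t -> fixed M x ->
  act s (act t x) = act t (act s x).
Proof.
move=> Ss St Mx.
by rewrite -!actM (commgC s t) (actM (t * s)%g) (Mx _ (MR Ss St)).
Qed.

(* A fixed point of [s] yields one in the set of fixed points of [M], on which
   [S] acts through its abelian quotient: [s] then fixes a whole [S]-orbit, which
   accumulates at [a] and at [b]. *)
Let fix_M s z : S s -> a < z < b -> act s z = z -> M s.
Proof.
move=> Ss zab sz; have [x0 x0ab Mx0] := Mfix.
have [t St tz] := orbital_lt x0ab zab.
pose x1 := act t x0; have x1ab := orbital_in St x0ab; rewrite -/x1 in x1ab tz.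
have Mx1 : fixed M x1 by exact: fixedM_act.
(* This orbit consists of fixed points of [M] below [z]; its supremum [w] is fixed by both [s] and
   [M]. *)
pose A := [set act (zexpg s n) x1 | n in setT].
have Az : ubound A z.
  by move=> _ [n _ <-]; rewrite -(act_fixZ n sz) act_le ltW.
have A0 : A !=set0 by exists x1, 0 => //; exact: act1g.
have Aub : has_ubound A by exists z.
pose w := sup A.
have x1w : x1 <= w by apply: ub_le_sup => //; exists 0 => //; exact: act1g.
have wz : w <= z by exact: ge_sup.
have wab : a < w < b by lra.
have sw : act s w = w.
  apply: sup_fix => // _ [n _ <-].
    by exists (1 + n) => //; rewrite zexpgS actM.
  by exists (n - 1) => //; rewrite zexpgP actM.
have Mw : fixed M w.
  apply: fixed_sup => // _ [n _ <-].
  by apply: fixedM_act => //; exact: subgroupZ.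
have sorb t' : S t' -> act s (act t' w) = act t' w.
  by move=> St'; rewrite fixedM_comm// sw.
split=> //; split.
  (* Fixed points of [s] accumulate at [a], which forces slope [1] there; likewise at [b]. *)
  have [m m0 sm] := germ_ex a s (or_introl erefl : sign 1).
  have [e e0 sE] := sm; suff m1 : m = 1 by move: sm; rewrite m1.
  have [|d [d0 de dab]] := @small_pos e (b - a) e0; first by rewrite subr_gt0.
  have [||t' St' td] := @orbital_lt w (a + d); [lra|lra|].
  have /andP[ta _] := orbital_in St' wab.
  have := sorb t' St'; have := sE (act t' w - a).
  rewrite (_ : a + 1 * (act t' w - a) = act t' w); last by ring.
  move=> ->; last by lra.
  rewrite (Sa Ss) => h.
  have n0 : act t' w - a != 0 by rewrite subr_eq0 gt_eqF.
  by apply: (mulIf n0); lra.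
have [m m0 sm] := germ_ex b s (or_intror erefl : sign (-1)).
have [e e0 sE] := sm; suff m1 : m = 1 by move: sm; rewrite m1.
have [|d [d0 de dab]] := @small_pos e (b - a) e0; first by rewrite subr_gt0.
have [||t' St' td] := @orbital_gt w (b - d); [lra|lra|].
have /andP[_ tb] := orbital_in St' wab.
have := sorb t' St'; have := sE (b - act t' w).
rewrite (_ : b + -1 * (b - act t' w) = act t' w); last by ring.
move=> ->; last by lra.
rewrite (Sb Ss) => h.
have n0 : b - act t' w != 0 by rewrite subr_eq0 gt_eqF.
by apply: (mulIf n0); lra.
Qed.

(** A trivial germ at [a] gives fixed points inside the orbital, and [fix_M] then controls the other
    end too. *)
Let slope1_M s : S s -> germ 1 a s 1 -> M s.
Proof.
move=> Ss /(germ1P (Sa Ss))[e e0 sE].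
have [|d [d0 de dab]] := @small_pos e (b - a) e0; first by rewrite subr_gt0.
apply: (fix_M (z := a + 1 * d)) => //; first by lra.
by apply: sE; rewrite ltW.
Qed.

(** Near [a] points move to the right; by [fix_M] there is no fixed point in the orbital, so by
    [crossing] the direction never changes. *)
Let slope_gt1 s nu : S s -> germ 1 a s nu -> 1 < nu ->
  forall x, a < x < b -> x < act s x.
Proof.
move=> Ss snu nu1 x xab.
have nofix w : a < w < b -> act s w <> w.
  move=> wab /(fix_M Ss wab)[_ [s1 _]].
  have sgn : sign (1 : R) by left.
  by have := germ_inj sgn s1 snu; lra.
have [z zab zs] : exists2 z, a < z < b & z < act s z.
  have [e e0 sE] := snu.
  have [|d [d0 de dab]] := @small_pos e (b - a) e0; first by rewrite subr_gt0.
  exists (a + 1 * d); first by lra.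
  have : 0 < (nu - 1) * d by rewrite mulr_gt0//; lra.
  by rewrite sE ?(ltW d0)// Sa//; lra.
rewrite ltNge; apply/negP; rewrite le_eqVlt => /orP[/eqP sx|sx].
  exact: (nofix x).
have [zx|xz|xz] := ltgtP z x; last by rewrite xz in zs; lra.
  by have [w wzx /nofix] := crossing zx zs sx; apply; lra.
have [||w wzx sw] := crossing (f := s^-1%g) xz.
- by rewrite -(act_lt s) actKV.
- by rewrite -(act_lt s) actKV.
by apply: (nofix w); [lra|rewrite -[in LHS]sw actKV].
Qed.

Let slope_cmp s nu : S s -> germ 1 a s nu -> 0 < nu ->
  (nu = 1 /\ M s) \/ (1 < nu /\ forall x, a < x < b -> x < act s x)
  \/ (nu < 1 /\ forall x, a < x < b -> act s x < x).
Proof.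
move=> Ss snu nu0; have [nu1|nu1|nu1] := ltgtP nu 1.
- right; right; split=> // x xab.
  rewrite -[X in _ < X](actK s); apply: (slope_gt1 (nu := nu^-1)).
  - exact: subgroupV.
  - by apply: germV => //; exact: Sa.
  - by rewrite invf_gt1.
  - exact: orbital_in.
- by right; left; split=> //; exact: slope_gt1 snu nu1.
- by left; split=> //; apply: slope1_M => //; move: snu; rewrite nu1.
Qed.


Let slope_ex s : S s -> exists2 nu : R, 0 < nu & germ 1 a s nu.
Proof. by move=> _; apply: germ_ex; left. Qed.

(** In the orbital [M] has a fixed point and [S] has none, so some element of [S] lies outside [M];
    it or its inverse expands at [a]. *)
Let expanding_ex : exists y mu, [/\ S y, germ 1 a y mu & 1 < mu].
Proof.
have [x0 x0ab Mx0] := Mfix.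
have [s Ss nMs] : exists2 s, S s & ~ M s.
  apply: contrapT => SM; apply: (Sfix x0ab) => s Ss; apply: Mx0.
  by apply: contrapT => nMs; apply: SM; exists s.
have [nu nu0 snu] := slope_ex Ss.
have [[_ //]|[[nu1 _]|[nu1 _]]] := slope_cmp Ss snu nu0; first by exists s, nu.
exists s^-1%g, nu^-1; split; first exact: subgroupV.
  by apply: germV => //; exact: Sa.
by rewrite invf_gt1.
Qed.

Lemma right_moving_gt y x c : (forall x, a < x < b -> x < act y x) ->
  act y a = a -> act y b = b -> a < x < b -> c < b ->
  exists n, c < act (zexpg y n) x.
Proof.
move=> yr ya yb xab cb.
have [||_ [n _ <-] h] := @displace _ _ x (Num.max x c) (subgroup_cyclic y).
- by rewrite le_max lexx.
- move=> z; rewrite le_max => /andP[xz zxc] yz.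
  have : z < act y z by apply: yr; case/orP: zxc; lra.
  by rewrite yz ?ltxx//; exists 1.
by exists n; apply: le_lt_trans h; rewrite le_max lexx orbT.
Qed.

Let contracting_b k nu : S k -> germ (-1) b k nu ->
  (forall x, a < x < b -> x < act k x) -> nu < 1.
Proof.
move=> Sk [e e0 kE] kr.
have [|d [d0 de dab]] := @small_pos e (b - a) e0; first by rewrite subr_gt0.
have dI : a < b + -1 * d < b by lra.
have := kr _ dI; rewrite kE ?(ltW d0)// (Sb Sk) => h.
by rewrite -(ltr_pM2r d0); lra.
Qed.

(** The contraction in [scaling] is the inverse of an expanding [y]; the range [e] depends on [y]
    alone and so serves all [k]. *)
Let scaling_a : exists2 e : R, 0 < e & forall k nu Z, S k -> germ 1 a k nu ->
    1 < nu -> 0 < Z -> nu * Z <= e -> fixed M (a + Z) ->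
  act k (a + Z) = a + nu * Z.
Proof.
have [y [mu [Sy ymu mu1]]] := expanding_ex.
have mu0 : 0 < mu by exact: lt_trans mu1.
have [e e0 yE] := germV mu0 (Sa Sy) ymu; rewrite (act_fixV (Sa Sy)) in yE.
exists e => // k nu Z Sk knu nu1 Z0 Ze MZ.
have ZnuZ : Z < nu * Z by rewrite ltr_pMl.
have := @scaling 1 a y^-1%g k mu^-1 nu e Z (act_fixV (Sa Sy)) (Sa Sk).
rewrite !mul1r; apply=> //.
- by rewrite invr_gt0.
- by rewrite invf_lt1.
- move=> n; apply: fixedM_comm => //.
  by apply: (subgroupZ n) => //; exact: subgroupV.
- by apply/andP; split; lra.
- by apply/andP; split; lra.
Qed.

Let scaling_b : exists2 e : R, 0 < e & forall k nu Z, S k -> germ (-1) b k nu ->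
    0 < nu -> nu < 1 -> 0 < Z -> Z <= e -> fixed M (b - Z) ->
  act k (b - Z) = b - nu * Z.
Proof.
have [y [mu [Sy ymu mu1]]] := expanding_ex.
have yr := slope_gt1 Sy ymu mu1.
have [mu' mu'0 ymu'] := germ_ex b y (or_intror erefl : sign (-1)).
have mu'1 := contracting_b Sy ymu' yr.
have [e e0 yE] := ymu'; rewrite (Sb Sy) in yE.
exists e => // k nu Z Sk knu nu0 nu1 Z0 Ze MZ.
have ZnuZ : nu * Z < Z by rewrite gtr_pMl.
have ZnuZ0 : 0 < nu * Z by rewrite mulr_gt0.
have := @scaling (-1) b y k mu' nu e Z (Sb Sy) (Sb Sk).
rewrite !mulN1r; apply=> //.
- by move=> n; apply: fixedM_comm => //; exact: (subgroupZ n).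
- by rewrite (ltW Z0).
- by apply/andP; split; lra.
Qed.

(** Start from a fixed point of [M] closer to [a] than [d] and apply [k] until the distance,
    multiplied by [nu] each time, first reaches [d]. *)
Let scaled_fixed k nu (d e : R) : S k -> 1 < nu -> 0 < d -> d < b - a ->
    (forall Z, 0 < Z -> nu * Z <= e -> fixed M (a + Z) ->
      act k (a + Z) = a + nu * Z) ->
    nu * d <= e ->
  exists X, [/\ d <= X, X < nu * d & fixed M (a + X)].
Proof.
move=> Sk nu1 d0 dab kE de; have nu0 : 0 < nu by exact: lt_trans nu1.
have [x0 x0ab Mx0] := Mfix.
have [|t St xp] := @orbital_lt x0 (a + d) x0ab; first by lra.
have /andP[xa _] := orbital_in St x0ab.
have Mx := fixedM_act St Mx0; set x := act t x0 in xp xa Mx.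
pose X0 := x - a; have X00 : 0 < X0 by rewrite subr_gt0.
have X0d : X0 < d by rewrite /X0; lra.
have exj : exists j, d <= nu ^+ j * X0.
  have [j jX] := expr_unbounded (d / X0) nu1.
  by exists j; rewrite -ler_pdivrMr.
have [j dj jmin] := ex_minnP exj.
have j0 : (0 < j)%N by case: (j) dj => //; rewrite mul1r leNgt X0d.
have jd : nu ^+ j * X0 < nu * d.
  case: (j) j0 jmin => // i _ imin; rewrite exprS -mulrA ltr_pM2l//.
  by rewrite ltNge; apply/negP => /imin; rewrite ltnn.
exists (nu ^+ j * X0); split=> //.
have Xpos i : 0 < nu ^+ i * X0 by rewrite mulr_gt0 ?exprn_gt0.
suff : forall i, (i <= j)%N -> fixed M (a + nu ^+ i * X0) by apply.
elim=> [_|i IHi ij]; first by rewrite expr0 mul1r /X0 addrC subrK.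
have Mi := IHi (ltnW ij).
rewrite exprS -mulrA -kE//; first exact: fixedM_act.
apply: le_trans de; apply: le_trans (ltW jd).
by rewrite mulrA -exprS ler_pM2r// ler_eXn2l.
Qed.

(* If the slope [nu] of [k] at [a] were too close to [1], three consecutive
   points of an orbit of [k] would lie in an interval to the right of [a + d] that
   [f = y ^ n] maps affinely to a neighbourhood of [b]. As [f] commutes with [k]
   on fixed points of [M], it conjugates the expansion by [nu] at [a] to a
   contraction by [nu'] at [b], which is absurd. *)
Let slope_gap : exists2 rho : R, 1 < rho &
  forall k nu, S k -> germ 1 a k nu -> 1 < nu -> rho <= nu.
Proof.
have [e1 e10 kaE] := scaling_a; have [e2 e20 kbE] := scaling_b.
have [y [mu [Sy ymu mu1]]] := expanding_ex.
have yr := slope_gt1 Sy ymu mu1.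
have ab0 : 0 < b - a by rewrite subr_gt0.
have e12 : 0 < e1 / 2 by rewrite divr_gt0.
have [d [d0 de1 dab]] := small_pos e12 ab0.
have dI : a < a + d < b by apply/andP; split; lra.
have e2b : b - e2 < b by lra.
have [n fp] := right_moving_gt yr (Sa Sy) (Sb Sy) dI e2b.
have Sf : S (zexpg y n) by exact: subgroupZ.
set f := zexpg y n in fp Sf.
have [B _ [e3 e30 fB]] := germ_ex (a + d) f (or_introl erefl : sign 1).
have [|P1 [P10 P1e3 P1e1]] := @small_pos e3 (e1 - d) e30; first by lra.
have [|P2 [P20 P21 P2ab]] := @small_pos P1 (b - a - d) P10; first by lra.
(* The cube allows for [X < nu * d] followed by two applications of [k], all within the range
   [d + P2] where [f] is affine. *)
have rho1 : 1 < (d + P2) / d by rewrite ltr_pdivlMr//; lra.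
have [rho rho1' rho3] := cube_root_gt1 rho1.
exists rho => // k nu Sk knu nu1; rewrite leNgt; apply/negP => nurho.
have nu0 : 0 < nu by exact: lt_trans nu1.
have nu3 : nu ^+ 3 * d <= d + P2.
  rewrite -ler_pdivlMr//; apply: le_trans rho3.
  rewrite lerXn2r ?nnegrE; [by []|exact: ltW| |exact: ltW].
  by rewrite ltW// (lt_trans nu0).
have kr := slope_gt1 Sk knu nu1.
have [nu' nu'0 knu'] := germ_ex b k (or_intror erefl : sign (-1)).
have nu'1 := contracting_b Sk knu' kr.
have {}kaE Z := kaE k nu Z Sk knu nu1.
have {}kbE Z := kbE k nu' Z Sk knu' nu'0 nu'1.
have nud : nu * d <= e1.
  apply: (@le_trans _ _ (nu ^+ 3 * d)); last by lra.
  by rewrite ler_pM2r// -{1}(expr1 nu) ler_eXn2l.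
have [X [dX Xd MX]] := scaled_fixed Sk nu1 d0 dab kaE nud.
have X00 : 0 < X by exact: lt_le_trans dX.
have X1 : X < nu * X by rewrite ltr_pMl.
have X2 : nu * X < nu * (nu * X) by rewrite ltr_pM2l.
have X3 : nu * (nu * X) < d + P2.
  apply: lt_le_trans nu3; rewrite [nu ^+ 3](exprS _ 2) -mulrA ltr_pM2l//.
  by rewrite expr2 -mulrA ltr_pM2l.
have X4 : nu * (nu * X) <= e1 by lra.
have fM z : fixed M z -> act k (act f z) = act f (act k z).
  by move=> Mz; exact: fixedM_comm.
have k0 : act k (a + X) = a + nu * X by apply: kaE => //; lra.
have M1 : fixed M (a + nu * X) by rewrite -k0; exact: fixedM_act.
have k1 : act k (a + nu * X) = a + nu * (nu * X).
  by apply: kaE => //; exact: lt_trans X1.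
have fE Z : d <= Z <= d + P2 -> act f (a + Z) = act f (a + d) + B * (Z - d).
  move=> dZ; have := fB (Z - d); rewrite !mul1r => <-; last by lra.
  by congr act; ring.
pose Y := b - act f (a + X).
have bY : act f (a + X) = b - Y by rewrite /Y; ring.
have Ye : Y <= e2.
  have : act f (a + d) <= act f (a + X) by rewrite act_le lerD2l.
  by rewrite /Y; lra.
have Y0 : 0 < Y.
  rewrite subr_gt0; have /andP[] // : a < act f (a + X) < b.
  by apply: orbital_in => //; lra.
have nuY : nu' * Y < Y by rewrite gtr_pMl.
have nuY0 : 0 < nu' * Y by rewrite mulr_gt0.
have f1 : act f (a + nu * X) = b - nu' * Y.
  rewrite -k0 -fM// bY kbE// -bY; exact: fixedM_act.
have f2 : act f (a + nu * (nu * X)) = b - nu' * (nu' * Y).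
  rewrite -k1 -fM// f1 kbE//; first by lra.
  by rewrite -f1; exact: fixedM_act.
rewrite fE in bY; last by lra.
rewrite fE in f1; last by lra.
rewrite fE in f2; last by lra.
(* An affine map preserves the ratio of successive gaps, which is [nu] before [f] and [nu'] after
   it; yet [nu' < 1 < nu]. *)
have d1 : B * (nu * X - X) = Y - nu' * Y by lra.
have d2 : B * (nu * (nu * X) - nu * X) = nu' * (Y - nu' * Y) by lra.
have d3 : nu * (Y - nu' * Y) = nu' * (Y - nu' * Y) by rewrite -d2 -d1; ring.
have /mulIf h : Y - nu' * Y != 0 by rewrite gt_eqF// subr_gt0.
by have := h _ _ d3; lra.
Qed.

(** A slope [mu] within the factor [rho] of the infimum is minimal: a smaller [nu] would give the
    slope [mu / nu] strictly between [1] and [rho]. *)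
Let generator : exists y mu, [/\ S y, germ 1 a y mu, 1 < mu &
  forall k nu, S k -> germ 1 a k nu -> 1 < nu -> mu <= nu].
Proof.
have [rho rho1 gap] := slope_gap.
pose A := [set nu : R | 1 < nu /\ exists2 k, S k & germ 1 a k nu].
have A1 : lbound A 1 by move=> nu [nu1 _]; exact: ltW.
have A0 : A !=set0.
  have [y [mu [Sy ymu mu1]]] := expanding_ex.
  by exists mu; split=> //; exists y.
have infA : has_inf A by split=> //; exists 1.
have inf1 : 1 <= inf A by apply: lb_le_inf.
have eps : 0 < inf A * (rho - 1).
  by rewrite mulr_gt0 ?subr_gt0//; exact: lt_le_trans inf1.
have [mu [mu1 [y Sy ymu]] muL] := inf_adherent eps infA.
exists y, mu; split=> // k nu Sk knu nu1; rewrite leNgt; apply/negP => numu.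
have nu0 : 0 < nu by exact: lt_trans nu1.
have infnu : inf A <= nu by apply: ge_inf; [exists 1|split=> //; exists k].
have : rho <= mu / nu.
  apply: (gap (y * k^-1)%g).
  - by apply: subgroupM => //; exact: subgroupV.
  - apply: germM; rewrite ?invr_ge0 ?(ltW nu0) ?act_fixV ?Sa//.
    by apply: germV => //; exact: Sa.
  - by rewrite ltr_pdivlMr// mul1r.
rewrite ler_pdivlMr//; apply/negP; rewrite -ltNge; apply: lt_le_trans muL _.
have rho0 : 0 < rho by exact: lt_trans rho1.
have : rho * inf A <= rho * nu by rewrite ler_pM2l.
lra.
Qed.

Definition right_moving y := forall x, a < x < b -> x < act y x.

Let zexpg_le y x (i j : int) : S y -> right_moving y -> a < x < b -> i <= j ->
  act (zexpg y i) x <= act (zexpg y j) x.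
Proof.
move=> Sy yr xab ij; have -> : j = `|j - i|%N%:Z + i by lia.
elim: `|j - i|%N => [|n IHn]; first by rewrite add0r.
rewrite -add1n PoszD -addrA zexpgS actM; apply: (le_trans IHn).
by apply: ltW; apply: yr; apply: orbital_in => //; exact: subgroupZ.
Qed.

Let tiling y x0 x : S y -> right_moving y -> a < x0 < b -> a < x < b ->
  exists n, act (zexpg y n) x0 <= x < act (zexpg y (n + 1)) x0.
Proof.
move=> Sy yr x0ab xab; have [[_ x0b] [_ xb]] := (andP x0ab, andP xab).
have [N xN] := right_moving_gt yr (Sa Sy) (Sb Sy) x0ab xb.
have [N' xN'] := right_moving_gt yr (Sa Sy) (Sb Sy) xab x0b.
have {}xN' : act (zexpg y (- N')) x0 < x.
  by rewrite -(act_lt (zexpg y N')) -actM -zexpgD subrr act1g.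
(* Counting from [- N'] makes the search one over natural numbers; [xN'] excludes the value [0]. *)
have exn : exists n : nat, x < act (zexpg y (- N' + n%:Z)) x0.
  exists (absz (N + N')); apply: (lt_le_trans xN); apply: zexpg_le => //; lia.
have [n xn nmin] := ex_minnP exn; case: n xn nmin => [|n] xn nmin.
  by move: xn; rewrite addr0 ltNge ltW.
exists (- N' + n%:Z); rewrite leNgt; apply/andP; split.
  by apply/negP => /nmin; rewrite ltnn.
by rewrite -addrA -PoszD addn1.
Qed.

(** Division with remainder: [e s] is the index of the tile [[y^n x0, y^(n+1) x0)] containing
    [act s x0]. *)
Let decomposition : exists y x0 (e : PLo R -> int),
  [/\ S y, right_moving y, a < x0 < b, fixed M x0 &
      forall s, S s -> M (zexpg y (- e s) * s)%g].
Proof.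
have [y [mu [Sy ymu mu1 mumin]]] := generator.
have yr : right_moving y by exact: slope_gt1 Sy ymu mu1.
have [x0 x0ab Mx0] := Mfix.
suff ex s : exists n, S s -> M (zexpg y (- n) * s)%g.
  exists y, x0, (fun s => sval (cid (ex s))); split=> // s.
  by case: cid.
have [Ss|] := pselect (S s); last by exists 0.
have [n /andP[xn nx]] := tiling Sy yr x0ab (orbital_in Ss x0ab).
exists n => _; set t := (_ * _)%g.
have St : S t by apply: subgroupM => //; exact: subgroupZ.
have {}xn : x0 <= act t x0.
  by rewrite /t actM -(act_le (zexpg y n)) -actM -zexpgD subrr act1g.
have {}nx : act t x0 < act y x0.
  by rewrite -(act_lt (zexpg y n)) /t -!actM mulgA -zexpgD subrr mul1g -zexpgSr.
have [nu nu0 tnu] := slope_ex St.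
(* If the remainder [t] had slope above [1], then [t y^-1], which moves [y x0] to the left, would
   have slope [nu / mu] below [1], against the minimality of [mu]. *)
have [[_ //]|[[nu1 _]|[_ /(_ _ x0ab)]]] := slope_cmp St tnu nu0; last first.
  by rewrite ltNge xn.
have nuy : germ 1 a (t * y^-1)%g (nu / mu).
  apply: germM => //; rewrite ?act_fixV ?Sa// ?invr_ge0 ?ltW//.
    exact: lt_trans mu1.
  by apply: germV; [exact: lt_trans mu1|exact: Sa|].
have Sty : S (t * y^-1)%g by apply: subgroupM => //; exact: subgroupV.
have mu0 : 0 < mu by exact: lt_trans mu1.
have y0ab := orbital_in Sy x0ab.
move: nx; rewrite -[X in act t X](actK y) -actM.
have [[_ Mty]|[[_ /(_ _ y0ab) tyr]|[]]] := slope_cmp Sty nuy (divr_gt0 nu0 mu0).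
- by rewrite (fixedM_act Sy Mx0 Mty) ltxx.
- by rewrite ltNge (ltW tyr).
- by rewrite ltr_pdivrMr// mul1r ltNge (mumin t nu).
Qed.

(** The interval from [x0] to [act y x0] is a fundamental domain for [y]. By [derived_descent] with
    [G = M] and [T = S], [D] hosts the action of [M] on it; the coordinate [f s j] records the base
    part [m s] on the translate by [y^j]. *)
Lemma orbital_hosts n D g V :
    (forall s, derived_series n.+1 S s -> trivial_on s a b) ->
    subgroup D -> hosts n D -> displacing D g -> subgroup V -> D `<=` V ->
    V g ->
  exists phi : PLo R -> PLo R, [/\ forall s, S s -> V (phi s),
    forall s t, S s -> S t -> phi (s * t)%g = (phi s * phi t)%g &
    forall s, S s -> (phi s = 1%g <-> trivial_on s a b)].
Proof.
move=> Sn gD hD Dg gV DV Vg.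
have [y [x0 [e [Sy yr x0ab Mx0 Me]]]] := decomposition.
have SZ i : S (zexpg y i) by exact: subgroupZ.
have e_uniq i : M (zexpg y i) -> i = 0.
  move=> /Mx0 yi; have yd : displaced y x0 x0 by left; exact: yr.
  by apply: (displaced_zexpg yd (x := x0)); rewrite ?yi lexx.
have eP s i : S s -> M (zexpg y (- i) * s)%g -> e s = i.
  move=> Ss Mi; have := subgroupM gM Mi (subgroupV gM (Me s Ss)).
  rewrite invgM -zexpgN opprK mulgA mulgK -zexpgD => /e_uniq; lia.
have eM s t : S s -> S t -> e (s * t)%g = e s + e t.
  move=> Ss St; apply: eP; first exact: subgroupM.
  rewrite (_ : _ * (s * t) = ((zexpg y (e t))^-1 * (zexpg y (- e s) * s) *
    zexpg y (e t)) * (zexpg y (- e t) * t))%g.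
    by apply: (subgroupM gM); [apply: MJ => //; exact: Me|exact: Me].
  by rewrite opprD addrC zexpgD !(zexpgN y (e t)) -!mulgA mulVKg.
have [m mE] : exists m : PLo R -> PLo R,
    forall s, m s = (s * zexpg y (- e s))%g by eexists.
have Mm s : S s -> M (m s).
  move=> Ss; rewrite mE; have := MJ (Me s Ss) (SZ (- e s)).
  by rewrite -zexpgN opprK !mulgA -zexpgD subrr mul1g.
have y0ab := orbital_in Sy x0ab.
have [phi [phiD phiM phi1]] : exists phi : PLo R -> PLo R,
    [/\ forall s, M s -> D (phi s),
      forall s t, M s -> M t -> phi (s * t)%g = (phi s * phi t)%g &
      forall s, M s -> (phi s = 1%g <-> trivial_on s x0 (act y x0))].
  apply: hD => //; first exact: fixedM_act.
  move=> s Ms x xI.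
  apply: (derived_descent (G := M) (T := S) (r := n) ab) Ms _ _ => //.
  - by move=> h [].
  - by move=> u v; exact: orbital_gt.
  - by lra.
pose f s j := phi (zexpg y (- j) * m s * zexpg y j)%g.
have Mf s j : S s -> M (zexpg y (- j) * m s * zexpg y j)%g.
  by move=> Ss; rewrite zexpgN; apply: MJ => //; exact: Mm.
have f1 s j : S s -> f s j = 1%g <->
    trivial_on (m s) (act (zexpg y j) x0) (act (zexpg y (j + 1)) x0).
  move=> Ss; rewrite /f phi1; last exact: Mf.
  split=> h x xI.
    have := h (act (zexpg y (- j)) x).
    rewrite (actM (_ * m s)%g) (actM _ (m s)).
    rewrite -(actM (zexpg y j)) -zexpgD subrr act1g => hx.
    apply: (act_inj (f := zexpg y (- j))); apply: hx.
    rewrite -(act_le (zexpg y j)) -(act_le (zexpg y j) _ (act y x0)).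
    rewrite -[act (zexpg y j) (act y x0)]actM -zexpgSr -actM -zexpgD.
    by rewrite subrr act1g.
  rewrite (actM (_ * m s)%g) (actM _ (m s)) h ?zexpgN ?actK//.
  by rewrite zexpgSr actM !act_le.
(* The base part is trivial near [a] and [b], so only the tiles from that of [u] to that of [v]
   matter. *)
have fl s : S s -> exists l : seq int, forall j, j \notin l -> f s j = 1%g.
  move=> Ss; have [_ mab] := Mm s Ss; have Sm : S (m s) := MS (Mm s Ss).
  have [u [v [au uv vb m1]]] := trivial_endsP ab (Sa Sm) (Sb Sm) mab.
  have uab : a < u < b by lra.
  have vab : a < v < b by lra.
  have [i /andP[iu ui]] := tiling Sy yr x0ab uab.
  have [k /andP[kv vk]] := tiling Sy yr x0ab vab.
  exists (int_range i k) => j jl.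
  apply: (proj2 (f1 s j Ss)) => x /andP[jx xj]; apply: m1.
  have [ja _] := andP (orbital_in (SZ j) x0ab).
  have [_ jb] := andP (orbital_in (SZ (j + 1)) x0ab).
  have [ji|ij] := ltP j i.
    left; rewrite (le_trans (ltW ja) jx)/=; apply: le_trans xj _.
    by apply: le_trans iu; apply: zexpg_le; rewrite ?lezD1.
  have [kj|jk] := ltP k j.
    right; rewrite (le_trans xj (ltW jb)) andbT; apply: le_trans jx.
    by apply: le_trans (ltW vk) _; apply: zexpg_le; rewrite ?lezD1.
  by case/negP: jl; exact: mem_int_range.
have fM s t j : S s -> S t -> f (s * t)%g j = (f s j * f t (j - e s))%g.
  move=> Ss St; rewrite /f -phiM; [congr phi|exact: Mf|exact: Mf].
  rewrite !mE eM// -!mulgA; congr (_ * (_ * _))%g.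
  rewrite (mulgA (zexpg y j)) -(zexpgD y j) (mulgA (zexpg y (- e s))).
  rewrite -(zexpgD y (- e s)).
  rewrite (_ : - e s + (j + - (j - e s)) = 0) ?mul1g; last by ring.
  by rewrite -!zexpgD; congr (_ * zexpg _ _)%g; ring.
have [Phi [PhiV PhiM Phi1]] := @wreath_hom _ D g V S e f gD Dg gV DV Vg gS
  (fun s j Ss => phiD _ (Mf s j Ss)) fl eM fM.
exists Phi; split=> // s Ss; rewrite Phi1//; split=> [[e0 fs]|s1].
  have sE : s = m s by rewrite mE e0 oppr0 mulg1.
  move=> x /andP[]; rewrite le_eqVlt => /orP[/eqP<- _|ax]; first exact: Sa.
  rewrite le_eqVlt => /orP[/eqP->|xb]; first exact: Sb.
  have xab : a < x < b by rewrite ax.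
  have [j /andP[jx xj]] := tiling Sy yr x0ab xab.
  by rewrite sE; have h := proj1 (f1 s j Ss) (fs j); apply: h; rewrite jx ltW.
have e0 : e s = 0.
  apply: eP => //; rewrite mul1g; apply: (fix_M (z := x0)) => //.
  by apply: s1; lra.
split=> // j; apply: (proj2 (f1 s j Ss)) => x /andP[jx xj].
rewrite mE e0 oppr0 mulg1; apply: s1.
have [ja _] := andP (orbital_in (SZ j) x0ab).
have [_ jb] := andP (orbital_in (SZ (j + 1)) x0ab).
by rewrite (le_trans (ltW ja) jx) (le_trans xj (ltW jb)).
Qed.

End Orbital.

(** * The embedding *)

Section Embedding.
Variable R : realType.
Implicit Types (f g s t y : PLo R) (S D U V : set (PLo R)) (x z a b : R).

Lemma fixed_inf S (A : set R) : subgroup S -> A !=set0 -> has_lbound A ->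
  (forall x, A x -> fixed S x) -> fixed S (inf A).
Proof.
move=> gS A0 Alb AS.
have le g : S g -> act g (inf A) <= inf A.
  move=> Sg; apply: lb_le_inf => // x Ax.
  by rewrite -[X in _ <= X](AS x Ax _ Sg) act_le; exact: ge_inf.
move=> f Sf; apply/le_anti; rewrite le//=.
by rewrite -(act_le f^-1%g) actK le//; exact: subgroupV.
Qed.

Definition orbital S a b :=
  [/\ fixed S a, fixed S b & forall x, a < x < b -> ~ fixed S x].

Lemma orbital_ex S a b x : subgroup S -> fixed S a -> fixed S b ->
    a <= x <= b -> ~ fixed S x ->
  exists a' b', [/\ orbital S a' b', a <= a', a' < x < b' & b' <= b].
Proof.
move=> gS Sa Sb /andP[ax xb] Sx.
pose A := [set z | z <= x /\ fixed S z]; pose B := [set z | x <= z /\ fixed S z].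
have Aa : A a by []. have Bb : B b by [].
have Aub : has_ubound A by exists x => z [].
have Blb : has_lbound B by exists x => z [].
have SA : fixed S (sup A) by apply: fixed_sup => //; [exists a|move=> z []].
have SB : fixed S (inf B) by apply: fixed_inf => //; [exists b|move=> z []].
have Ax : sup A <= x by apply: ge_sup => [|z []//]; exists a.
have xB : x <= inf B by apply: lb_le_inf => [|z []//]; exists b.
exists (sup A), (inf B); split.
- split=> // z /andP[Az zB] Sz; have [zx|xz] := leP z x.
    by move: Az; rewrite ltNge ub_le_sup.
  by move: zB; rewrite ltNge ge_inf//; split=> //; exact: ltW.
- exact: ub_le_sup.
- rewrite !lt_neqAle Ax xB !andbT.
  by apply/andP; split; apply/eqP => xE; apply: Sx; rewrite -?xE// xE.
- exact: ge_inf.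
Qed.

(** An end of the first interval strictly inside the second would be a fixed point there. Used both
    ways, this makes orbitals with a common point equal. *)
Lemma orbital_sub S a b a' b' x : orbital S a b -> orbital S a' b' ->
  a < x < b -> a' < x < b' -> a <= a' /\ b' <= b.
Proof.
move=> [Sa Sb _] [_ _ nofix] /andP[ax xb] /andP[ax' xb'].
split; rewrite leNgt; apply/negP => h.
  by apply: (nofix a) => //; rewrite h (lt_trans ax).
by apply: (nofix b) => //; rewrite h andbT (lt_trans ax').
Qed.

(** An affine map fixing both ends is the identity. This bounds the number of orbitals on which [s]
    is non-trivial. *)
Lemma orbital_break a b s (B : seq R) : a < b -> act s a = a -> act s b = b ->
    (forall a b : R, (forall x, x \in B -> ~~ (a < x < b)) ->
      exists m c : R, forall x, a <= x <= b -> act s x = m * x + c) ->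
    ~ trivial_on s a b ->
  exists2 c, c \in B & a < c < b.
Proof.
move=> ab sa sb sB ns; apply: contrapT => noc; apply: ns => x xab.
have [|m [c sE]] := sB a b.
  by move=> c cB; apply/negP => cab; apply: noc; exists c.
have aE : act s a = m * a + c by apply: sE; rewrite lexx ltW.
have bE : act s b = m * b + c by apply: sE; rewrite lexx ltW.
have m1 : m = 1.
  have ab0 : b - a != 0 by rewrite subr_eq0 gt_eqF.
  by apply: (mulIf ab0); lra.
by rewrite sE// m1; rewrite m1 in aE; lra.
Qed.

Definition rat_point (i : nat) : R := ratr (odflt 0%Q (unpickle i)).

Lemma rat_point_dense a b : a < b -> exists i, a < rat_point i < b.
Proof.
move=> ab; have [q] := rat_in_itvoo ab; rewrite in_itv/= => qab.
by exists (pickle q); rewrite /rat_point pickleK.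
Qed.

(* The first rational of an orbital names it, so there are countably many
   orbitals. *)
Definition leader S a b i := [/\ a <= rat_point i <= b,
  ~ fixed S (rat_point i) &
  forall j, (j < i)%N -> exists2 z, fixed S z &
    Num.min (rat_point j) (rat_point i) <= z
      <= Num.max (rat_point j) (rat_point i)].

(** Take the least index of a rational in the orbital: an end of the orbital separates it from every
    rational of smaller index. *)
Lemma leader_ex S a b a' b' : orbital S a' b' -> a <= a' -> a' < b' -> b' <= b ->
  exists2 i, leader S a b i & a' < rat_point i < b'.
Proof.
move=> [Sa' Sb' nofix] aa' ab' bb'.
have [i /andP[ai ib] imin] := ex_minnP (rat_point_dense ab').
have iI : a' < rat_point i < b' by rewrite ai.
exists i => //; split; [by apply/andP; split; lra|exact: nofix|move=> k ki].
have : ~~ (a' < rat_point k < b').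
  by apply/negP => /imin; rewrite leqNgt ki.
rewrite negb_and -!leNgt => /orP[ka|bk].
  by exists a' => //; rewrite ge_min le_max ka (ltW ai) orbT.
by exists b' => //; rewrite ge_min le_max bk (ltW ib) !orbT.
Qed.

Lemma leader_uniq S a b a1 b1 a2 b2 i j c :
    leader S a b i -> leader S a b j -> orbital S a1 b1 -> orbital S a2 b2 ->
    a1 < rat_point i < b1 -> a2 < rat_point j < b2 ->
    a1 < c < b1 -> a2 < c < b2 ->
  i = j.
Proof.
move=> + + oi oj iI jI ci cj.
have [a12 b21] := orbital_sub oi oj ci cj.
have [a21 b12] := orbital_sub oj oi cj ci.
have no n m : a1 < rat_point n < b1 -> a1 < rat_point m < b1 ->
    leader S a b m -> (n < m)%N -> False.
  move=> /andP[an nb] /andP[am mb] [_ _ mP] /mP[z Sz].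
  rewrite ge_min le_max => /andP[z1 z2]; have [_ _ nofix] := oi.
  apply: (nofix z) => //; apply/andP; split.
    by case/orP: z1; apply: lt_le_trans.
  by case/orP: z2 => h; apply: le_lt_trans h _.
have jI' : a1 < rat_point j < b1.
  by have [ja jb] := andP jI; rewrite (le_lt_trans a12)// (lt_le_trans jb).
move=> li lj; have [ij|ji|//] := ltngtP i j; first by case: (no i j).
by case: (no j i).
Qed.

(** The group [U] receives each orbital through [orbital_hosts]. A second wreath product, with
    exponent [0] throughout, puts the images for distinct orbitals on distinct translates and so
    forms their direct sum in [V]. *)
Lemma hosts_step n D U V y y' : subgroup D -> hosts n D -> displacing D y ->
    subgroup U -> D `<=` U -> U y -> displacing U y' ->
    subgroup V -> U `<=` V -> V y' ->
  hosts n.+1 V.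
Proof.
move=> gD hD Dy gU DU Uy Uy' gV UV Vy' S a b gS Sa Sb Str.
have ex i : exists pab : (PLo R -> PLo R) * (R * R),
    [/\ forall s, S s -> U (pab.1 s),
      forall s t, S s -> S t -> pab.1 (s * t)%g = (pab.1 s * pab.1 t)%g,
      forall s, S s -> (pab.1 s = 1%g <->
        (leader S a b i -> trivial_on s pab.2.1 pab.2.2)) &
      leader S a b i -> [/\ orbital S pab.2.1 pab.2.2, a <= pab.2.1,
        pab.2.1 < rat_point i < pab.2.2 & pab.2.2 <= b]].
  have [li|nli] := pselect (leader S a b i); last first.
    exists (fun=> 1%g, (a, b)); split=> // *; first exact: subgroup1.
    by rewrite mulg1.
  have [iab Si _] := li.
  have [a1 [b1 [oS aa1 ab1 bb1]]] := orbital_ex gS Sa Sb iab Si.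
  have [Sa1 Sb1 nofix] := oS.
  have tr s : derived_series n.+1 S s -> trivial_on s a1 b1.
    by move=> /Str str x xab; apply: str; lra.
  have a1b1 : a1 < b1 by case/andP: ab1; exact: lt_trans.
  have [phi [phiU phiM phi1]] :=
    orbital_hosts a1b1 gS Sa1 Sb1 nofix tr tr gD hD Dy gU DU Uy.
  exists (phi, (a1, b1)); split=> // s Ss; rewrite /= phi1//.
  by split=> // /(_ li).
pose phi i := (sval (cid (ex i))).1; pose lo i := (sval (cid (ex i))).2.1.
pose hi i := (sval (cid (ex i))).2.2.
have phiU i s : S s -> U (phi i s).
  by rewrite /phi; case: cid => ? [h _ _ _] /=; exact: h.
have phiM i s t : S s -> S t -> phi i (s * t)%g = (phi i s * phi i t)%g.
  by rewrite /phi; case: cid => ? [_ h _ _] /=; exact: h.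
have phi1 i s : S s ->
    (phi i s = 1%g <-> (leader S a b i -> trivial_on s (lo i) (hi i))).
  by rewrite /phi /lo /hi; case: cid => ? [_ _ h _] /=; exact: h.
have lohi i : leader S a b i -> [/\ orbital S (lo i) (hi i), a <= lo i,
    lo i < rat_point i < hi i & hi i <= b].
  by rewrite /lo /hi; case: cid => ? [_ _ _ h] /=; exact: h.
clearbody phi lo hi.
pose f s (j : int) := if j is Posz i then phi i s else 1%g.
have [s j Ss|s Ss|s t Ss St|s t j Ss St|Phi [PhiV PhiM Phi1]] :=
  @wreath_hom _ U y' V S (fun=> 0) f gU Uy' gV UV Vy' gS.
- by case: j => i /=; [exact: phiU|exact: subgroup1].
(* A breakpoint lies in at most one named orbital; the indices of these orbitals contain the support
   of [f s]. *)
- have [B sB] := act_affine s.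
  have idx_ex c : exists i, forall j, leader S a b j -> lo j < c < hi j -> j = i.
    have [[i [li ci]]|noi] :=
        pselect (exists i, leader S a b i /\ lo i < c < hi i).
      exists i => j lj cj.
      have [oi _ iI _] := lohi i li; have [oj _ jI _] := lohi j lj.
      exact: (leader_uniq lj li oj oi jI iI cj ci).
    by exists 0%N => j lj cj; case: noi; exists j.
  pose idx c := sval (cid (idx_ex c)).
  have idxP c j : leader S a b j -> lo j < c < hi j -> j = idx c.
    by rewrite /idx; case: cid => i /= h; exact: h.
  exists [seq (idx c)%:Z | c <- B] => -[j|//] jB; apply/phi1 => // lj.
  have [[Sl Sh _] _ /andP[lj1 lj2] _] := lohi j lj.
  apply: contrapT => ntr.
  have [c cB cj] := orbital_break (lt_trans lj1 lj2) (Sl s Ss) (Sh s Ss) sB ntr.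
  by case/negP: jB; apply/mapP; exists c => //; rewrite -(idxP c j).
- by rewrite addr0.
- by rewrite subr0; case: j => i /=; [exact: phiM|rewrite mulg1].
exists Phi; split=> // s Ss; rewrite Phi1//; split=> [[_ fs] x xab|str].
  apply: contrapT => sx.
  have Sx : ~ fixed S x by move=> /(_ s Ss).
  have [a1 [b1 [oS aa1 /andP[ax xb] bb1]]] := orbital_ex gS Sa Sb xab Sx.
  have [i li ii] := leader_ex oS aa1 (lt_trans ax xb) bb1.
  have [oi _ ii' _] := lohi i li.
  have [la hb] := orbital_sub oi oS ii' ii.
  apply: sx; apply: (proj1 (phi1 i s Ss) (fs i%:Z) li x).
  by rewrite (le_trans la (ltW ax)) (le_trans (ltW xb)).
split=> // -[i|//]; apply/phi1 => // li x xi; apply: str.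
have [_ la _ hb] := lohi i li; lra.
Qed.

(** Each level descends two derived subgroups: the list for [n] lies in the second one, the first
    displacing element in the first one, and the other in [H]. *)
Lemma nonsolvable_hosts n H : subgroup H -> ~ is_solvable H ->
  exists l, (forall f, f \in l -> H f) /\ hosts n (generated l).
Proof.
elim: n H => [|n IHn] H gH nH.
  by exists [::]; split=> //; apply: hosts0; exact: subgroup_generated.
have gH' := subgroup_derived H; have nH' := nonsolvable_derived nH.
have [l [lH hl]] := IHn _ (subgroup_derived _) (nonsolvable_derived nH').
have [l1 [y [l1H l01 ly ldy]]] := nonsolvable_displacing gH' nH' lH.
have [l2 [z [l2H l12 lz ldz]]] := nonsolvable_displacing gH nH l1H.
exists l2; split=> //.
by apply: (hosts_step _ hl ldy _ l01 ly ldz _ l12 lz); exact: subgroup_generated.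
Qed.

End Embedding.

Theorem corollary1p2 (R : realType) (S H : set (PLo R))
    (hS : subgroup S) (hH : subgroup H)
    (solvS : is_solvable S) (nsolvH : ~ is_solvable H) :
  exists K : set (PLo R), [/\ subgroup K, K `<=` H & isomorphic S K].
Proof.
have [n Sn] := solvS.
have [l [lH hl]] := nonsolvable_hosts n hH nsolvH.
have S0 : fixed S 0 by move=> s _; exact: act0.
have S1 : fixed S 1 by move=> s _; exact: act1.
(* On [[0, 1]] the kernel condition of [hosts] says that [phi] is injective on [S]. *)
have [s|phi [phiD phiM phi1]] := hl S 0 1 hS S0 S1.
  by rewrite Sn => -> x _; exact: act1g.
have phiV s : S s -> phi s^-1%g = (phi s)^-1%g.
  move=> Ss; apply/esym/mulg1_eq; rewrite -phiM//; last exact: subgroupV.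
  rewrite mulgV; apply/phi1; first exact: subgroup1.
  by move=> x _; exact: act1g.
exists (phi @` S); split.
- apply: subgroupP => [|_ _ [s Ss <-] [t St <-]|_ [s Ss <-]].
  + exists 1%g; first exact: subgroup1.
    apply/phi1; first exact: subgroup1.
    by move=> x _; exact: act1g.
  + by exists (s * t)%g; [exact: subgroupM|exact: phiM].
  + by exists s^-1%g; [exact: subgroupV|exact: phiV].
- by move=> _ [s Ss <-]; apply: (generated_sub hH lH); exact: phiD.
exists phi; split; first by move=> s t /set_mem Ss /set_mem St; exact: phiM.
split=> [s Ss|s t /set_mem Ss /set_mem St st|//]; first by exists s.
apply: divg1_eq; have Sst : S (s * t^-1)%g.
  by apply: subgroupM => //; exact: subgroupV.
have /phi1 tr : phi (s * t^-1)%g = 1%g.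
  by rewrite phiM ?phiV ?st ?mulgV//; exact: subgroupV.
apply: act_ext => x; rewrite act1g.
have [x01|x01] := boolP (0 <= x <= 1); first exact: tr.
by rewrite act_out.
Qed.
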